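(* Let $R$ be a pmp equivalence relation on a standard probability space $(X,\mu)$, and let $E$ and $F$ be finite dynamical generating sets for $R$. Then $s(E)=s(F)$, $\underline{s}(E)=\underline{s}(F)$, and $s_\omega(E)=s_\omega(F)$ for every nonprincipal ultrafilter $\omega$ on $\mathbb N$.
   Context: Let $(X,\mu)$ be a standard probability space and $R\subseteq X\times X$ a countable Borel equivalence relation preserving $\mu$ (a pmp equivalence relation). $\llbracket R\rrbracket$ denotes the set of partial Borel bijections $s:\operatorname{dom}s\to\operatorname{ran}s$ between Borel subsets of $X$ with $(x,s(x))\in R$ for all $x\in\operatorname{dom}s$, identified when they agree off a null set; measure preservation means $\mu(\operatorname{dom}s)=\mu(\operatorname{ran}s)$. The product $st$ is $(st)(x)=s(t(x))$ on $\operatorname{dom}(st)=t^{-1}(\operatorname{ran}t\cap\operatorname{dom}s)$; $s^{-1}$ is the inverse map; $1$ is the identity of $X$ and $0$ the empty map. Elements $s_1,\dots,s_k$ are pairwise orthogonal if their domains are pairwise disjoint and their ranges are pairwise disjoint; their sum $\sum_i s_i$ is the element equal to $s_i$ on $\operatorname{dom}s_i$. For $F\subseteq\llbracket R\rrbracket$, $\mathbf\Sigma F$ is the set of all finite sums of pairwise orthogonal elements of $F$, $F_\pm=F\cup\{s^{-1}:s\in F\}\cup\{1\}$, and $F_\pm^n$ is the set of products of $n$ elements of $F_\pm$. The uniform distance is $|s-t|=\mu\{x\in\operatorname{dom}s\cup\operatorname{dom}t: s(x)\neq t(x)\}$, where by convention $s(x)\neq t(x)$ whenever $x\in\operatorname{dom}s\,\triangle\,\operatorname{dom}t$;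 the trace is $\tau(s)=\mu\{x\in\operatorname{dom}s: s(x)=x\}$. For $d\in\mathbb N$, $\llbracket d\rrbracket$ is the same structure for the full equivalence relation on $\{1,\dots,d\}$ with the uniform probability measure (partial permutations), with distance $|\cdot|$ and trace $\operatorname{tr}(\sigma)=\frac1d\#\{i\in\operatorname{dom}\sigma:\sigma(i)=i\}$. Microstates: for finite $F\subseteq\llbracket R\rrbracket$, $n,d\in\mathbb N$, $\delta>0$, ${\rm SA}(F,n,\delta,d)$ is the set of maps $\varphi:\llbracket R\rrbracket\to\llbracket d\rrbracket$ with $\varphi(1)=1$ such that $|\varphi(st)-\varphi(s)\varphi(t)|<\delta$ for all $s,t\in\mathbf\Sigma F_\pm^n$ with $st\in\mathbf\Sigma F_\pm^n$, and $|\operatorname{tr}(\varphi(s))-\tau(s)|<\delta$ for all $s\in\mathbf\Sigma F_\pm^n$. ${\rm NSA}(F,n,\delta,d)$ is the number of distinct restrictions $\varphi|_F$ with $\varphi\in{\rm SA}(F,n,\delta,d)$. Set $s(F,n,\delta)=\limsup_{d\to\infty}\frac{1}{d\log d}\log{\rm NSA}(F,n,\delta,d)$ (with $\log 0=-\infty$), $s(F,n)=\inf_{\delta>0}s(F,n,\delta)$, $s(F)=\inf_{n\in\mathbb N}s(F,n)$. $\underline s(F)$ is defined the same way with $\liminf_{d\to\infty}$, and for a nonprincipal ultrafilter $\omega$ on $\mathbb N$, $s_\omega(F)$ with $\lim_{d\to\omega}$. A set $F\subseteq\llbracket R\rrbracket$ is a dynamical generating set for $R$ if for every $t\in\llbracket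 R\rrbracket$ and $\varepsilon>0$ there are $n\in\mathbb N$ and $s\in\mathbf\Sigma F_\pm^n$ with $|t-s|<\varepsilon$. *)

(* Defs.v *)
From HB Require Import structures.
From mathcomp Require Import all_boot all_order all_algebra.
From mathcomp Require Import all_classical all_reals all_analysis.
From Stdlib Require List.

Set Implicit Arguments.
Unset Strict Implicit.
Unset Printing Implicit Defensive.

Import Order.TTheory GRing.Theory Num.Theory.
Local Open Scope classical_set_scope.
Local Open Scope ring_scope.

(* Standard Borel spaces: X is Borel-isomorphic to a Borel subset of R *)
Definition standard_borel (R : realType) (d : measure_display)
  (X : measurableType d) : Prop :=
  exists f : X -> R, injective f /\ measurable_fun setT f /\
    (forall A : set X, measurable A -> measurable (f @` A)).

Definition countable_borel_equiv (d : measure_display) (X : measurableType d)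
  (Rel : X -> X -> Prop) : Prop :=
  [/\ (forall x, Rel x x), (forall x y, Rel x y -> Rel y x),
      (forall x y z, Rel x y -> Rel y z -> Rel x z),
      measurable [set p : X * X | Rel p.1 p.2] &
      (forall x, countable [set y | Rel x y])].

(* Partial Borel bijections between Borel subsets of X (representatives). *)
Record pbij (d : measure_display) (X : measurableType d) := PBij {
  pdom : set X; pran : set X; pf : X -> X; pg : X -> X;
  pdom_m : measurable pdom; pran_m : measurable pran;
  pf_m : measurable_fun pdom pf; pg_m : measurable_fun pran pg;
  pf_ran : forall x, pdom x -> pran (pf x);
  pg_dom : forall y, pran y -> pdom (pg y);
  pgf : forall x, pdom x -> pg (pf x) = x;
  pfg : forall y, pran y -> pf (pg y) = y }.

Arguments pdom {d X}. Arguments pran {d X}. Arguments pf {d X}. Arguments pg {d X}.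

Definition inR (d : measure_display) (X : measurableType d)
  (Rel : X -> X -> Prop) (s : pbij X) : Prop :=
  forall x, pdom s x -> Rel x (pf s x).

Definition pid (d : measure_display) (X : measurableType d) : pbij X.
Proof.
refine (@PBij d X setT setT id id measurableT measurableT
  (@measurable_id _ X setT) (@measurable_id _ X setT) _ _ _ _); by [].
Defined.

Definition pinv (d : measure_display) (X : measurableType d) (s : pbij X) : pbij X :=
  @PBij d X (pran s) (pdom s) (pg s) (pf s) (@pran_m _ _ s) (@pdom_m _ _ s)
    (@pg_m _ _ s) (@pf_m _ _ s) (@pg_dom _ _ s) (@pf_ran _ _ s) (@pfg _ _ s) (@pgf _ _ s).

Definition pmul (d : measure_display) (X : measurableType d) (s t : pbij X) : pbij X.
Proof.
refine (@PBij d X (pdom t `&` pf t @^-1` pdom s) (pran s `&` pg s @^-1` pran t)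
  (pf s \o pf t) (pg t \o pg s) _ _ _ _ _ _ _ _).
- exact: (@pf_m _ _ t (@pdom_m _ _ t) _ (@pdom_m _ _ s)).
- exact: (@pg_m _ _ s (@pran_m _ _ s) _ (@pran_m _ _ t)).
- apply: (measurable_comp (@pdom_m _ _ s)); last first.
    by apply: (measurable_funS (@pdom_m _ _ t) _ (@pf_m _ _ t)) => x [].
  + exact: pf_m.
  + by move=> _ [x [_ ?] <-].
- apply: (measurable_comp (@pran_m _ _ t)); last first.
    by apply: (measurable_funS (@pran_m _ _ s) _ (@pg_m _ _ s)) => x [].
  + exact: pg_m.
  + by move=> _ [x [_ ?] <-].
- move=> x [Dx Dtx] /=; split; first exact: pf_ran.
  by rewrite /preimage /= pgf //; exact: pf_ran.
- move=> y [Ry Rgy] /=; split; first exact: pg_dom.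
  by rewrite /preimage /= pfg //; exact: pg_dom.
- by move=> x [Dx Dtx] /=; rewrite pgf // pgf.
- by move=> y [Ry Rgy] /=; rewrite pfg // pfg.
Defined.

Section Measure.
Context (R : realType) (d : measure_display) (X : measurableType d).
Local Open Scope ereal_scope.

Definition ae_eq (mu : set X -> \bar R) (s t : pbij X) : Prop :=
  exists N : set X, [/\ measurable N, mu N = 0 &
    forall x, (pdom s x \/ pdom t x) -> ~ N x ->
      [/\ pdom s x, pdom t x & pf s x = pf t x]].

Definition udist (mu : set X -> \bar R) (s t : pbij X) : \bar R :=
  mu [set x | (pdom s x \/ pdom t x) /\
              ~ [/\ pdom s x, pdom t x & pf s x = pf t x]].

Definition tau (mu : set X -> \bar R) (s : pbij X) : \bar R :=
  mu [set x | pdom s x /\ pf s x = x].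

End Measure.

Definition pmp (R : realType) (d : measure_display) (X : measurableType d)
  (mu : set X -> \bar R) (Rel : X -> X -> Prop) : Prop :=
  forall s : pbij X, inR Rel s -> mu (pdom s) = mu (pran s).

Definition Fpm (d : measure_display) (X : measurableType d)
  (F : seq (pbij X)) (s : pbij X) : Prop :=
  List.In s F \/ (exists u, List.In u F /\ s = pinv u) \/ s = pid X.

Fixpoint FPn (d : measure_display) (X : measurableType d)
  (F : seq (pbij X)) (n : nat) (s : pbij X) : Prop :=
  match n with
  | O => s = pid X
  | S m => exists u v, Fpm F u /\ FPn F m v /\ s = pmul u v
  end.

Fixpoint orth_list (d : measure_display) (X : measurableType d)
  (L : seq (pbij X)) : Prop :=
  match L with
  | [::] => True
  | s :: L' => (forall u, List.In u L' ->
                  pdom s `&` pdom u = set0 /\ pran s `&` pran u = set0)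
               /\ orth_list L'
  end.

Definition is_sum (d : measure_display) (X : measurableType d)
  (L : seq (pbij X)) (t : pbij X) : Prop :=
  pdom t = foldr (fun s A => pdom s `|` A) set0 L /\
  (forall s, List.In s L -> forall x, pdom s x -> pf t x = pf s x).

(* t \in Sigma (F_pm^n), as a set of representatives closed under a.e. equality *)
Definition SigF (R : realType) (d : measure_display) (X : measurableType d)
  (mu : set X -> \bar R) (F : seq (pbij X)) (n : nat) (t : pbij X) : Prop :=
  exists L : seq (pbij X),
    [/\ (forall s, List.In s L -> exists p, FPn F n p /\ ae_eq mu s p),
        orth_list L &
        exists t', is_sum L t' /\ ae_eq mu t t'].

Definition dyn_gen (R : realType) (d : measure_display) (X : measurableType d)
  (mu : set X -> \bar R) (Rel : X -> X -> Prop) (F : seq (pbij X)) : Prop :=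
  forall t : pbij X, inR Rel t -> forall eps : R, 0 < eps ->
    exists n s, SigF mu F n s /\ (udist mu t s < eps%:E)%E.

Definition ppinj (n : nat) (f : {ffun 'I_n -> option 'I_n}) : bool :=
  [forall i, forall j, (f i != None) && (f i == f j) ==> (i == j)].

Definition pperm (n : nat) := {f : {ffun 'I_n -> option 'I_n} | ppinj f}.

Definition pp_one (n : nat) : {ffun 'I_n -> option 'I_n} := [ffun i => Some i].

Definition pp_mul (n : nat) (f g : {ffun 'I_n -> option 'I_n})
  : {ffun 'I_n -> option 'I_n} := [ffun i => obind f (g i)].

Definition pp_dist (R : realType) (n : nat) (f g : {ffun 'I_n -> option 'I_n}) : R :=
  #|[set i | f i != g i]|%:R / n%:R.

Definition pp_tr (R : realType) (n : nat) (f : {ffun 'I_n -> option 'I_n}) : R :=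
  #|[set i | f i == Some i]|%:R / n%:R.

Definition SA (R : realType) (d : measure_display) (X : measurableType d)
  (mu : set X -> \bar R) (F : seq (pbij X)) (n : nat) (delta : R) (D : nat)
  (phi : pbij X -> pperm D) : Prop :=
  [/\ (forall s t, ae_eq mu s t -> phi s = phi t), (* phi is a map on [[R]] *)
      val (phi (pid X)) = pp_one D,
      (forall s t, SigF mu F n s -> SigF mu F n t -> SigF mu F n (pmul s t) ->
         pp_dist R (val (phi (pmul s t))) (pp_mul (val (phi s)) (val (phi t))) < delta) &
      (forall s, SigF mu F n s ->
         `| pp_tr R (val (phi s)) - fine (tau mu s) | < delta)].

Definition NSA (R : realType) (d : measure_display) (X : measurableType d)
  (mu : set X -> \bar R) (F : seq (pbij X)) (n : nat) (delta : R) (D : nat) : nat :=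
  #|[set t : (size F).-tuple (pperm D) |
       `[< exists phi, SA mu F n delta phi /\ [seq phi s | s <- F] = tval t >]]|.

Definition sterm (R : realType) (d : measure_display) (X : measurableType d)
  (mu : set X -> \bar R) (F : seq (pbij X)) (n : nat) (delta : R) (D : nat) : \bar R :=
  if NSA mu F n delta D == 0%N then -oo%E
  else (ln (NSA mu F n delta D)%:R / (D%:R * ln D%:R))%:E.

Local Open Scope ereal_scope.

Definition s_up (R : realType) (d : measure_display) (X : measurableType d)
  (mu : set X -> \bar R) (F : seq (pbij X)) : \bar R :=
  ereal_inf (range (fun n : nat =>
    ereal_inf [set limn_esup (sterm mu F n delta) | delta in [set delta : R | (0 < delta)%R]])).

Definition s_low (R : realType) (d : measure_display) (X : measurableType d)
  (mu : set X -> \bar R) (F : seq (pbij X)) : \bar R :=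
  ereal_inf (range (fun n : nat =>
    ereal_inf [set limn_einf (sterm mu F n delta) | delta in [set delta : R | (0 < delta)%R]])).

Definition nonprincipal_ultrafilter (w : set (set nat)) : Prop :=
  [/\ w setT /\ ~ w set0,
      (forall A B, w A -> A `<=` B -> w B),
      (forall A B, w A -> w B -> w (A `&` B)),
      (forall A, w A \/ w (~` A)) &
      (forall k : nat, ~ w [set k])].

(* limit along w of a sequence in \bar R (exists and is unique by compactness) *)
Definition ulim (R : realType) (w : set (set nat)) (u : nat -> \bar R) : \bar R :=
  lim (fmap u w).

Definition s_ult (R : realType) (d : measure_display) (X : measurableType d)
  (mu : set X -> \bar R) (w : set (set nat)) (F : seq (pbij X)) : \bar R :=
  ereal_inf (range (fun n : nat =>
    ereal_inf [set ulim w (sterm mu F n delta) | delta in [set delta : R | (0 < delta)%R]])).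

(* Main.v *)
From Pilot Require Import Defs.
From HB Require Import structures.
From mathcomp Require Import all_boot all_order all_algebra.
From mathcomp Require Import all_classical all_reals all_analysis.
From mathcomp Require Import ring lra zify.
From Stdlib Require List.
Import Pilot.Defs.

(** Let phi be a microstate on (E, m, delta').  If phi is almost multiplicative
and trace preserving, then phi (b^-1) is almost inverse to phi b, and
tr (phi (b^-1) phi a) computes the proportion of points where phi a and phi b
agree; hence phi is almost Lipschitz (constant 2) for the uniform distance.
Modulo null sets there are finitely many elements in Sigma F_pm^n, and each is
close to some element c(s) of Sigma E_pm^k; by the Lipschitz bound, phi o c is a
microstate on (F, n, delta).  Conversely each e in E is close to an orthogonal
sum u of words in F.  A microstate psi on F is almost additive on such sums:
the pieces psi w_i have almost disjoint domains, agree with psi u on almost all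
of their domains, and have the right total size.  So phi e is determined by the
restriction of phi o c to F up to an error kappa in the Hamming distance, and
the number of E-restrictions over a given F-restriction is at most
2^(|E|D) (D+1)^(kappa |E| D).  On the scale D log D this costs O(kappa), and
exchanging the roles of E and F gives equality of the three limits. *)

Set Implicit Arguments.
Unset Strict Implicit.
Unset Printing Implicit Defensive.

Import Order.TTheory GRing.Theory Num.Theory.
Local Open Scope classical_set_scope.
Local Open Scope ring_scope.

(** * Densities of subsets of a finite set, and partial permutations up to small density *)

Section Density.
Local Open Scope set_scope.
Context (R : realType) (D : nat).
Implicit Types (S T U : {set 'I_D}) (f g h : {ffun 'I_D -> option 'I_D}).

Definition dens S : R := #|S|%:R / D%:R.

Lemma dens_ge0 S : 0 <= dens S.
Proof. by rewrite /dens divr_ge0 ?ler0n. Qed.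

Lemma dens_le S T : S \subset T -> dens S <= dens T.
Proof. by move=> ST; rewrite ler_wpM2r ?invr_ge0 ?ler0n// ler_nat subset_leq_card. Qed.

Lemma dens_leU S T U : S \subset T :|: U -> dens S <= dens T + dens U.
Proof.
move=> STU; rewrite -mulrDl ler_wpM2r ?invr_ge0 ?ler0n// -natrD ler_nat.
by apply: (leq_trans (subset_leq_card STU)); rewrite cardsU leq_subr.
Qed.

Lemma densBsub S T : S \subset T -> dens T = dens S + dens (T :\: S).
Proof.
by move=> /finset.setIidPr ST; rewrite -mulrDl -natrD -{1}ST cardsID.
Qed.

Lemma densUI S T : dens S + dens T = dens (S :|: T) + dens (S :&: T).
Proof. by rewrite -!mulrDl -!natrD cardsUI. Qed.

(** [f] maps the preimage injectively into [S]. *)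
Lemma dens_preim f S : ppinj f ->
  dens [set i | if f i is Some j then j \in S else false] <= dens S.
Proof.
move=> finj; rewrite ler_wpM2r ?invr_ge0 ?ler0n// ler_nat.
set P := [set i | _].
have [->|/set0Pn[i0 i0P]] := eqVneq P finset.set0; first by rewrite cards0.
(* The default [i0] only makes [F] total: on [P] every [f i] is a [Some]. *)
pose F i := odflt i0 (f i).
rewrite -(@card_in_imset _ _ F P); last first.
  move=> i j; rewrite !inE /F; case E1 : (f i) => [a|]//; case E2 : (f j) => [b|]//= _ _ ab.
  move/forallP: finj => /(_ i)/forallP/(_ j); rewrite E1 E2 ab eqxx /=.
  by move/eqP.
apply/subset_leq_card/fintype.subsetP => _ /imsetP[i + ->].
by rewrite inE /F; case: (f i).
Qed.

(* The set in [pp_dist] and [pp_tr] is a classical [set], not a [{set 'I_D}]. *)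
Lemma pp_distE f g : pp_dist R f g = dens [set i | f i != g i].
Proof.
by rewrite /pp_dist /dens; congr (_%:R / _); apply: eq_card => i; apply/idP/idP => /[!inE].
Qed.

Lemma pp_trE f : pp_tr R f = dens [set i | f i == Some i].
Proof.
by rewrite /pp_tr /dens; congr (_%:R / _); apply: eq_card => i; apply/idP/idP => /[!inE].
Qed.

Lemma pp_distC f g : pp_dist R f g = pp_dist R g f.
Proof. by rewrite !pp_distE; congr dens; apply/setP => i; rewrite !inE eq_sym. Qed.

Lemma pp_dist_triangle g f h : pp_dist R f h <= pp_dist R f g + pp_dist R g h.
Proof.
rewrite !pp_distE; apply: dens_leU; apply/fintype.subsetP => i; rewrite !inE.
by case: (eqVneq (f i) (g i)) => [->|].
Qed.

Lemma pp_dist_mull f g h : pp_dist R (pp_mul f g) (pp_mul f h) <= pp_dist R g h.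
Proof.
rewrite !pp_distE; apply: dens_le; apply/fintype.subsetP => i; rewrite !inE !ffunE.
by apply: contraNN => /eqP ->.
Qed.

Lemma pp_dist_mulr f g h : ppinj f ->
  pp_dist R (pp_mul g f) (pp_mul h f) <= pp_dist R g h.
Proof.
move=> finj; rewrite !pp_distE; apply: le_trans (dens_preim _ finj).
apply: dens_le; apply/fintype.subsetP => i; rewrite !inE !ffunE.
by case: (f i) => //= j; rewrite inE.
Qed.

Lemma pp_tr_dist f g : pp_tr R f <= pp_tr R g + pp_dist R f g.
Proof.
rewrite !pp_trE pp_distE; apply: dens_leU; apply/fintype.subsetP => i; rewrite !inE.
by case: (eqVneq (f i) (g i)) => [->|]; rewrite ?orbT ?orbF.
Qed.

Definition ppdom f : {set 'I_D} := [set i | f i != None].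

Definition agree f g : {set 'I_D} := [set i | (f i != None) && (f i == g i)].

(** The defect of [g] as a left inverse of [f]: the points of the domain of [f] that [g] does not
    bring back. *)
Definition nonret f g : {set 'I_D} :=
  [set i | (f i != None) && (obind g (f i) != Some i)].

Lemma ppinjP f i j : ppinj f -> f i != None -> f i = f j -> i = j.
Proof.
move=> /forallP/(_ i)/forallP/(_ j) + fi fij.
by rewrite fi fij eqxx /= => /eqP.
Qed.

(* If f (g f) is close to f then, f being injective, g f is close to the
   identity of dom f. *)
Lemma dens_nonret e f g h : ppinj f ->
  pp_dist R h (pp_mul g f) <= e -> pp_dist R f (pp_mul f h) <= e ->
  dens (nonret f g) <= 2 * e.
Proof.
move=> finj hgf ffh; have -> : 2 * e = e + e by ring.
apply: le_trans (lerD ffh hgf); rewrite !pp_distE.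
apply: dens_leU; apply/fintype.subsetP => i; rewrite !inE !ffunE.
case/andP => fi gfi; rewrite -negb_and; apply: contraNN gfi => /andP[/eqP E /eqP <-].
apply/eqP; case: (h i) E => /= [j|] E; first by rewrite (ppinjP finj fi E).
by rewrite E in fi.
Qed.

(** Off [nonret f g] the domain of [f] consists of fixed points of [g f], so a trace bounds its
    size. *)
Lemma dens_ppdom_le e f g h : pp_dist R h (pp_mul g f) <= e ->
  dens (ppdom f) <= pp_tr R h + e + dens (nonret f g).
Proof.
move=> hgf.
have /le_trans : dens (ppdom f) <= pp_tr R (pp_mul g f) + dens (nonret f g).
  rewrite pp_trE; apply: dens_leU; apply/fintype.subsetP => i; rewrite !inE !ffunE => -> /=.
  by case: eqP.
apply; rewrite lerD2r (le_trans (pp_tr_dist _ h))// lerD2l.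
by rewrite pp_distC.
Qed.

(** If [g' f] fixes [i] and [g] undoes [g'] at [f i], then [g i = f i]. The exceptional [i] lie in
    the preimage of [nonret g' g] under the injective [f]. *)
Lemma dens_agree_ge e f g g' h : ppinj f -> pp_dist R h (pp_mul g' f) <= e ->
  pp_tr R h <= dens (agree f g) + e + dens (nonret g' g).
Proof.
move=> finj hgf; apply: le_trans (pp_tr_dist _ (pp_mul g' f)) _.
rewrite addrAC lerD// pp_trE; apply: le_trans (_ : _ <= dens (agree f g) + dens
  [set i | if f i is Some j then j \in nonret g' g else false]) _; last first.
  by rewrite lerD2l dens_preim.
apply: dens_leU; apply/fintype.subsetP => i; rewrite !inE !ffunE.
case: (f i) => //= j; rewrite inE => /eqP E; rewrite E /=.
by rewrite eq_sym; case: eqP.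
Qed.

(** Up to [nonret], [f' f] and [g' g] are the identities of the two domains, so their product [k]
    fixes the intersection. The term [3 * e] pays for passing from [k] to [h]: one [e] for each
    factor and one for the product. *)
Lemma dens_ppdomI_le e f f' g g' h hf hg :
  pp_dist R hf (pp_mul f' f) <= e -> pp_dist R hg (pp_mul g' g) <= e ->
  ppinj hg ->
  pp_dist R h (pp_mul hf hg) <= e ->
  dens (ppdom f :&: ppdom g) <=
    pp_tr R h + 3 * e + dens (nonret f f') + dens (nonret g g').
Proof.
move=> dhf dhg hginj dh.
pose k := pp_mul (pp_mul f' f) (pp_mul g' g).
have dk : pp_dist R k h <= 3 * e.
  have -> : 3 * e = e + e + e by ring.
  apply: le_trans (pp_dist_triangle (pp_mul (pp_mul f' f) hg) _ _) _.
  rewrite -addrA lerD//.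
    by apply: le_trans (pp_dist_mull _ _ _) _; rewrite pp_distC.
  apply: le_trans (pp_dist_triangle (pp_mul hf hg) _ _) _.
  rewrite lerD//; last by rewrite pp_distC.
  by apply: le_trans (pp_dist_mulr _ _ hginj) _; rewrite pp_distC.
apply: le_trans (_ : _ <= pp_tr R k + (dens (nonret f f') + dens (nonret g g'))) _.
  have cov : ppdom f :&: ppdom g \subset
      [set i | k i == Some i] :|: (nonret f f' :|: nonret g g'); last first.
    by rewrite pp_trE (le_trans (dens_leU cov))// lerD2l dens_leU.
  apply/fintype.subsetP => i; rewrite !inE !ffunE.
  case/andP => fi gi; rewrite fi gi /=.
  case: (eqVneq (obind g' (g i)) (Some i)) => [->|_] /=; rewrite ?orbT//.
  by rewrite ffunE orbF; case: eqP.
rewrite addrA lerD2r lerD2r; apply: le_trans (pp_tr_dist _ h) _.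
by rewrite lerD2l.
Qed.

(** The maps differ only at points of either domain outside [agree f g], which lies in both domains
    and is therefore subtracted twice. *)
Lemma pp_dist_le_agree f g :
  pp_dist R f g <= dens (ppdom f) + dens (ppdom g) - 2 * dens (agree f g).
Proof.
have Ef : agree f g \subset ppdom f.
  by apply/fintype.subsetP => i; rewrite !inE => /andP[].
have Eg : agree f g \subset ppdom g.
  by apply/fintype.subsetP => i; rewrite !inE => /andP[fi /eqP <-].
have : pp_dist R f g <= dens (ppdom f :\: agree f g) + dens (ppdom g :\: agree f g).
  rewrite pp_distE; apply: dens_leU; apply/fintype.subsetP => i; rewrite !inE => fg.
  by rewrite (negbTE fg) andbF /= -negb_and; apply: contraNN fg => /andP[/eqP-> /eqP->].
by rewrite (densBsub Ef) (densBsub Eg); lra.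
Qed.

(** Near-uniqueness of inverses. If [g1 j = a] and [f a = j] but [g2 j] is not [a], then [a] lies in
    [nonret f g2]; such [j] form a preimage under the injective [g1]. The roles of [g1] and [g2] are
    symmetric. *)
Lemma pp_dist_quasi_inv f g1 g2 : ppinj g1 -> ppinj g2 ->
  pp_dist R g1 g2 <= dens (nonret g1 f) + dens (nonret g2 f)
                     + dens (nonret f g1) + dens (nonret f g2).
Proof.
move=> i1 i2.
pose B g h := [set j | if g j is Some i then i \in nonret f h else false] : {set 'I_D}.
have cov : [set i | g1 i != g2 i] \subset
   (nonret g1 f :|: nonret g2 f) :|: (B g2 g1 :|: B g1 g2).
  apply/fintype.subsetP => j; rewrite !inE.
  case E1 : (g1 j) => [a|]; case E2 : (g2 j) => [b|] //=; rewrite ?inE.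
  - move=> ab; case: (eqVneq (f a) (Some j)) => [fa|]//=.
    case: (eqVneq (f b) (Some j)) => [fb|]//=; rewrite fa fb /= E1 E2.
    by rewrite ab.
  - move=> _; rewrite ?orbF; case: (eqVneq (f a) (Some j)) => //= fa.
    by rewrite fa /= E2.
  - move=> _; rewrite ?orbF; case: (eqVneq (f b) (Some j)) => //= fb.
    by rewrite fb /= E1.
rewrite pp_distE; apply: le_trans (dens_leU cov) _.
rewrite -addrA; apply: lerD; first exact: dens_leU.
by apply: le_trans (dens_leU (fintype.subxx _)) _; rewrite lerD// dens_preim.
Qed.

End Density.

(** * Almost disjoint unions and almost additivity *)

Section DensityUnion.
Local Open Scope set_scope.
Context (R : realType) (D : nat).

Lemma dens_bigcup (I : eqType) (r : seq I) (S : I -> {set 'I_D}) :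
  dens R (\bigcup_(i <- r) S i) <= \sum_(i <- r) dens R (S i).
Proof.
elim: r => [|a r IH]; first by rewrite !big_nil /dens cards0 mul0r.
by rewrite !big_cons; apply: le_trans (dens_leU _ (fintype.subxx _)) _; rewrite lerD2l.
Qed.

(** Adding a set to a union of [k] earlier ones loses at most [k * b] in overlaps, and
    [k^2 + k <= (k + 1)^2]. *)
Lemma sum_dens_le_bigcup (I : eqType) (r : seq I) (S : I -> {set 'I_D}) (b : R) :
  0 <= b -> uniq r ->
  (forall i j, i \in r -> j \in r -> i != j -> dens R (S i :&: S j) <= b) ->
  \sum_(i <- r) dens R (S i) <= dens R (\bigcup_(i <- r) S i) + (size r ^ 2)%:R * b.
Proof.
move=> b0; elim: r => [|a r IH] /=.
  by rewrite !big_nil => _ _; rewrite mul0r addr0 dens_ge0.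
case/andP => ar ur H; rewrite !big_cons.
have {}IH := IH ur (fun i j ir jr => H i j (mem_behead (s := a :: r) ir)
                                           (mem_behead (s := a :: r) jr)).
have E := densUI R (S a) (\bigcup_(i <- r) S i).
have : dens R (S a :&: \bigcup_(i <- r) S i) <= (size r)%:R * b.
  rewrite big_distrr /=; apply: le_trans (dens_bigcup _ _) _.
  rewrite mulr_natl -[X in _ <= b *+ X](count_predT r) -iter_addr_0 -big_const_seq.
  rewrite big_seq [X in _ <= X]big_seq; apply: ler_sum => i ir.
  apply: H; rewrite ?mem_head// ?inE ?ir ?orbT//.
  by apply: contraNneq ar => ->.
have : (size r ^ 2)%:R * b + (size r)%:R * b <= ((size r).+1 ^ 2)%:R * b.
  rewrite -mulrDl ler_wpM2r// -natrD ler_nat; lia.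
lra.
Qed.

(* Density form of: if U1 is the disjoint union of the W1 i, and each W1 i
   agrees with W2 i, which is a restriction of U2, then U1 is a restriction
   of U2. *)
Lemma dens_disagree_sum (I : finType) (U1 U2 : {ffun 'I_D -> option 'I_D})
  (W1 W2 : I -> {ffun 'I_D -> option 'I_D}) (m : I -> R) (a b c e : R) :
  0 <= b ->
  dens R (ppdom U1) <= \sum_i m i + a ->
  (forall i, m i - a <= dens R (agree (W1 i) U1)) ->
  (forall i j, i != j -> dens R (ppdom (W1 i) :&: ppdom (W1 j)) <= b) ->
  (forall i, pp_dist R (W1 i) (W2 i) <= c) ->
  (forall i, dens R (ppdom (W2 i) :\: agree (W2 i) U2) <= e) ->
  dens R (ppdom U1 :\: agree U1 U2) <=
    a + #|I|%:R * (a + c + e) + (#|I| ^ 2)%:R * b.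
Proof.
move=> b0 hU hm hd hc he.
pose S i := agree (W1 i) U1.
pose Sx := \bigcup_(i <- enum I) S i.
(* The agreement sets [S i] are large and almost disjoint, so their union [Sx] has almost full size
   in the domain of [U1]. *)
have hS : \sum_i m i - #|I|%:R * a <= dens R Sx + (#|I| ^ 2)%:R * b.
  rewrite cardE; apply: le_trans (sum_dens_le_bigcup (S := S) b0 (enum_uniq I) _).
    rewrite big_enum /= -cardE; apply: le_trans (_ : _ <= \sum_i (m i - a)) _.
      by rewrite sumrB sumr_const mulr_natl.
    by apply: ler_sum => i _; exact: hm.
  move=> i j _ _ ij; apply: le_trans (hd i j ij); apply: dens_le.
  by apply/fintype.subsetP => x; rewrite !inE => /andP[/andP[-> _] /andP[-> _]].
have SU : Sx \subset ppdom U1.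
  apply/fintype.subsetP => x; rewrite /Sx big_enum /= => /finset.bigcupP[i _].
  by rewrite !inE => /andP[h /eqP <-].
have hdU := densBsub R SU.
(* On [S i] outside [T i] the chain [U1 = W1 i = W2 i = U2] holds. *)
pose T i := [set x | W1 i x != W2 i x] :|: (ppdom (W2 i) :\: agree (W2 i) U2).
have cov : ppdom U1 :\: agree U1 U2 \subset
    (ppdom U1 :\: Sx) :|: \bigcup_(i <- enum I) T i.
  apply/fintype.subsetP => x xU; rewrite inE.
  case: (boolP (x \in Sx)) => xS; last first.
    by apply/orP; left; rewrite inE xS /=; move: xU; rewrite inE => /andP[].
  apply/orP; right; move: xS; rewrite /Sx !big_enum /= => /finset.bigcupP[i _ xi].
  apply/finset.bigcupP; exists i => //; move: xU xi; rewrite !inE.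
  case/andP => xU U0 /andP[w0 /eqP wU]; move: xU; rewrite U0 /=.
  by rewrite -wU; case: (eqVneq (W1 i x) (W2 i x)) => //= <-; rewrite w0 /= => ->.
have hT : dens R (\bigcup_(i <- enum I) T i) <= #|I|%:R * (c + e).
  apply: le_trans (dens_bigcup _ _) _; rewrite big_enum /=.
  apply: le_trans (_ : _ <= \sum_(i : I) (c + e)) _; last first.
    by rewrite sumr_const mulr_natl.
  apply: ler_sum => i _; apply: le_trans (dens_leU _ (fintype.subxx _)) _.
  by apply: lerD => //; rewrite -pp_distE.
have := dens_leU R cov; lra.
Qed.

Lemma pp_dist_le_disagree (f g : {ffun 'I_D -> option 'I_D}) :
  pp_dist R f g <= dens R (ppdom f :\: agree f g) + dens R (ppdom g :\: agree g f).
Proof.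
rewrite pp_distE; apply: dens_leU; apply/fintype.subsetP => i; rewrite !inE => fg.
rewrite [g i == f i]eq_sym (negbTE fg) !andbF /= -negb_and.
by apply: contraNN fg => /andP[/eqP-> /eqP->].
Qed.

End DensityUnion.

(** * Cardinality of Hamming balls *)

Section HammingBall.
Local Open Scope set_scope.
Context (I T : finType).

(** A member of the ball is given by a set containing its disagreements with [f], at most [2 ^ #|I|]
    choices, and by its values on that set of at most [K] points. *)
Lemma card_hamming_ball (f : {ffun I -> T}) (K : nat) : (0 < #|T|)%N ->
  (#|[set g : {ffun I -> T} | (#|[set i | f i != g i]| <= K)%N]|
     <= 2 ^ #|I| * #|T| ^ K)%N.
Proof.
move=> T0.
pose B (A : {set I}) := [set g : {ffun I -> T} | [forall i, (i \notin A) ==> (f i == g i)]].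
have cov : [set g : {ffun I -> T} | (#|[set i | f i != g i]| <= K)%N] \subset
    \bigcup_(A in [set A : {set I} | #|A| <= K]%N) B A.
  apply/fintype.subsetP => g; rewrite inE => gK; apply/finset.bigcupP.
  exists [set i | f i != g i]; rewrite ?inE//.
  by apply/forallP => i; apply/implyP; rewrite inE negbK.
apply: leq_trans (subset_leq_card cov) _.
apply: leq_trans (_ : _ <= \sum_(A in [set A : {set I} | #|A| <= K]%N) #|B A|)%N _.
  elim/big_rec2: _ => [|A n S _ IH]; first by rewrite cards0.
  by apply: leq_trans (leq_card_setU _ _) _; rewrite leq_add2l.
apply: leq_trans (_ : _ <= \sum_(A in [set A : {set I} | #|A| <= K]%N) #|T| ^ K)%N _.
  apply: leq_sum => A; rewrite inE => AK.
  pose F i : pred T := if i \in A then predT else pred1 (f i).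
  have -> : #|B A| = #|finfun.family F|.
    apply: eq_card => g; rewrite inE; apply/forallP/familyP => H i; have := H i.
      rewrite /F; case: ifP => // iA /=.
      by rewrite inE eq_sym.
    by rewrite /F; case: ifP => //= iA; rewrite inE eq_sym.
  rewrite card_family foldrE big_map big_enum /=.
  apply: leq_trans (_ : _ <= \prod_(i in A) #|T|)%N _; last first.
    by rewrite prod_nat_const leq_pexp2l.
  rewrite (bigID (mem A)) /= [X in (_ * X)%N]big1 ?muln1; last first.
    by move=> i /negbTE iA; rewrite /F iA card1.
  by apply: leq_prod => i iA; rewrite max_card.
rewrite sum_nat_const leq_mul2r; apply/orP; right.
apply: leq_trans (max_card _) _.
by rewrite -cardsT -powersetT card_powerset cardsT.
Qed.

End HammingBall.

(** * Algebra of partial bijections and of words in a generating list *)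

Section PartialBijections.
Context (d : measure_display) (X : measurableType d).
Implicit Types (s t u v p q : pbij X) (F : seq (pbij X)).

(** The other fields are proofs, equal by proof irrelevance. The maps must agree off the domains
    too, as they do for the composites in the laws below; those laws are thus plain equalities. *)
Lemma pbij_eq s t : pdom s = pdom t -> pran s = pran t -> pf s = pf t ->
  pg s = pg t -> s = t.
Proof.
case: s => ? ? ? ? ? ? ? ? ? ? ? ?; case: t => ? ? ? ? ? ? ? ? ? ? ? ? /= *.
by subst; f_equal; exact: Prop_irrelevance.
Qed.

Lemma pmulA s t u : pmul s (pmul t u) = pmul (pmul s t) u.
Proof.
apply: pbij_eq => //=; apply/seteqP; split=> x /=; rewrite /preimage /=; tauto.
Qed.

Lemma pmul1l s : pmul (pid X) s = s.
Proof.
apply: pbij_eq => //=; apply/seteqP; split=> x /=; rewrite /preimage /=; tauto.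
Qed.

Lemma pmul1r s : pmul s (pid X) = s.
Proof.
apply: pbij_eq => //=; apply/seteqP; split=> x /=; rewrite /preimage /=; tauto.
Qed.

Lemma pinvM s t : pinv (pmul s t) = pmul (pinv t) (pinv s).
Proof. exact: pbij_eq. Qed.

Lemma pinvK s : pinv (pinv s) = s.
Proof. exact: pbij_eq. Qed.

Lemma pinv1 : pinv (pid X) = pid X.
Proof. exact: pbij_eq. Qed.

Lemma Fpm_inv F s : Fpm F s -> Fpm F (pinv s).
Proof.
case=> [Fs|[[u [Fu ->]]|->]]; last by rewrite pinv1; right; right.
  by right; left; exists s.
by rewrite pinvK; left.
Qed.

Lemma FPn_mul F n m p q : FPn F n p -> FPn F m q -> FPn F (n + m) (pmul p q).
Proof.
elim: n p => [|n IH] p /=; first by move=> ->; rewrite pmul1l.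
move=> [u [v [Fu [Fv ->]]]] Fq; exists u, (pmul v q); rewrite pmulA.
by split=> //; split=> //; exact: IH.
Qed.

Lemma FPn_Fpm F s : Fpm F s -> FPn F 1 s.
Proof. by move=> Fs; exists s, (pid X); rewrite pmul1r. Qed.

Lemma FPn_inv F n p : FPn F n p -> FPn F n (pinv p).
Proof.
elim: n p => [|n IH] p /=; first by move=> ->; rewrite pinv1.
move=> [u [v [Fu [Fv ->]]]]; rewrite pinvM.
have := FPn_mul (IH _ Fv) (FPn_Fpm (Fpm_inv Fu)).
by rewrite addn1.
Qed.

Lemma FPn1 F n : FPn F n (pid X).
Proof.
elim: n => [//|n IH] /=; exists (pid X), (pid X); rewrite pmul1l.
by split=> //; right; right.
Qed.

(** Words are padded with the identity, which belongs to [Fpm F]. *)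
Lemma FPn_mono F n m p : (n <= m)%N -> FPn F n p -> FPn F m p.
Proof.
by move=> nm Fp; rewrite -(subnK nm) -(pmul1l p); exact: FPn_mul (FPn1 _ _) Fp.
Qed.

Lemma FPn_finite F n : exists W : seq (pbij X), forall p, FPn F n p -> List.In p W.
Proof.
elim: n => [|n [W HW]] /=; first by exists [:: pid X] => p ->; left.
pose G := pid X :: F ++ [seq pinv u | u <- F].
exists (List.flat_map (fun u => [seq pmul u v | v <- W]) G) => p [u [v [Fu [Fv ->]]]].
apply/List.in_flat_map; exists u; split; last exact/List.in_map/HW.
rewrite /G /=; case: Fu => [Fu|[[w [Fw ->]]|->]]; last by left.
  by right; apply/List.in_app_iff; left.
by right; apply/List.in_app_iff; right; exact: List.in_map.
Qed.

Section Rel.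
Context (Rel : X -> X -> Prop).
Hypothesis RelE : countable_borel_equiv Rel.

Lemma inR_mul s t : inR Rel s -> inR Rel t -> inR Rel (pmul s t).
Proof.
case: RelE => _ _ tr _ _ Rs Rt x /= [tx stx].
by apply: tr (Rt _ tx) _; exact: Rs.
Qed.

Lemma inR_inv s : inR Rel s -> inR Rel (pinv s).
Proof.
case: RelE => _ sy _ _ _ Rs x /= sx; apply: sy.
by have := Rs _ (pg_dom sx); rewrite pfg.
Qed.

Lemma inR_id : inR Rel (pid X).
Proof. by case: RelE => rf _ _ _ _ x _; exact: rf. Qed.

Lemma inR_FPn F n p : (forall s, List.In s F -> inR Rel s) -> FPn F n p -> inR Rel p.
Proof.
move=> FR; elim: n p => [|n IH] p /=; first by move=> ->; exact: inR_id.
move=> [u [v [Fu [Fv ->]]]]; apply: inR_mul; last exact: IH.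
case: Fu => [/FR//|[[w [/FR Fw ->]]|->]]; [exact: inR_inv|exact: inR_id].
Qed.
End Rel.

(** Multiplying by it on the right restricts the domain to [A]; on the left it restricts the
    range. *)
Definition pidon (A : set X) (mA : measurable A) : pbij X.
Proof.
refine (@PBij d X A A id id mA mA (@measurable_id _ X A) (@measurable_id _ X A)
  _ _ _ _); by [].
Defined.

End PartialBijections.

(** * Almost everywhere equality, real-valued measure and the uniform distance *)

Section AlmostEverywhere.
Context (R : realType) (d : measure_display) (X : measurableType d)
  (mu : probability X R).
Implicit Types (s t u v p q : pbij X) (F : seq (pbij X)).

(** The condition of [ae_eq] at one point, so that null sets can be handled by the almost everywhere
    filter. *)
Definition ptwise_eq s t x :=
  (pdom s x \/ pdom t x) -> [/\ pdom s x, pdom t x & pf s x = pf t x].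

Lemma aeP (P : set X) :
  (\forall x \ae mu, P x) <-> exists N, [/\ measurable N, mu N = 0%E & forall x, ~ N x -> P x].
Proof.
split=> [[N [mN N0 H]]|[N [mN N0 H]]]; exists N; split=> //.
  by move=> x Nx; apply: contrapT => Px; apply: Nx; exact: H.
by move=> x /= Px; apply: contrapT => Nx; apply: Px; exact: H.
Qed.

Lemma ae_eqP s t : ae_eq mu s t <-> \forall x \ae mu, ptwise_eq s t x.
Proof.
rewrite aeP; split=> -[N [mN N0 H]]; exists N; split=> // x.
  by move=> Nx st; exact: H.
by move=> st Nx; exact: H.
Qed.

Lemma ae_eq_refl s : ae_eq mu s s.
Proof. by apply/ae_eqP/nearW => x; rewrite /ptwise_eq; case. Qed.

Lemma ae_eq_sym s t : ae_eq mu s t -> ae_eq mu t s.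
Proof.
move=> /ae_eqP st; apply/ae_eqP; apply: filterS st => x H ts.
have [|? ? ?] := H; first by case: ts; [right|left].
by split.
Qed.

Lemma ae_eq_trans t s u : ae_eq mu s t -> ae_eq mu t u -> ae_eq mu s u.
Proof.
move=> /ae_eqP st /ae_eqP tu; apply/ae_eqP; apply: filterS2 st tu => x H1 H2.
case=> h.
  by case: (H1 (or_introl h)) => sx tx ->; case: (H2 (or_introl tx)).
by case: (H2 (or_intror h)) => tx sx <-; case: (H1 (or_intror tx)).
Qed.

Definition mreal (A : set X) : R := fine (mu A).

Lemma mreal_ge0 A : 0 <= mreal A.
Proof. exact: fine_ge0. Qed.

Lemma mrealE A : measurable A -> mu A = (mreal A)%:E.
Proof. by move=> mA; rewrite fineK// fin_num_measure. Qed.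

Lemma mreal_le A B : measurable A -> measurable B -> A `<=` B -> mreal A <= mreal B.
Proof. by move=> mA mB AB; rewrite -lee_fin -!mrealE// le_measure ?inE. Qed.

Lemma mreal_leU A B C : measurable A -> measurable B -> measurable C ->
  A `<=` B `|` C -> mreal A <= mreal B + mreal C.
Proof.
move=> mA mB mC ABC; apply: le_trans (mreal_le mA (measurableU _ _ mB mC) ABC) _.
rewrite -lee_fin EFinD -!mrealE//; last exact: measurableU.
exact: measureU2.
Qed.

Lemma mreal_le_ae A B : measurable A -> measurable B ->
  (\forall x \ae mu, A x -> B x) -> mreal A <= mreal B.
Proof.
move=> mA mB /aeP[N [mN N0 H]].
have : A `<=` B `|` N.
  by move=> x Ax; case: (pselect (N x)) => Nx; [right|left; exact: H].
move=> /(mreal_leU mA mB mN).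
by rewrite {3}/mreal N0 /= addr0.
Qed.

Lemma mreal0 : mreal set0 = 0.
Proof. by rewrite /mreal measure0. Qed.

Lemma mreal_bigcup (I : eqType) (r : seq I) (A : I -> set X) :
  (forall i, measurable (A i)) ->
  mreal (\big[setU/set0]_(i <- r) A i) <= \sum_(i <- r) mreal (A i).
Proof.
move=> mA; elim: r => [|a r IH]; first by rewrite !big_nil mreal0.
rewrite !big_cons; apply: le_trans (_ : _ <= mreal (A a) + mreal (\big[setU/set0]_(i <- r) A i)) _.
  by apply: mreal_leU => //; [apply: measurableU => //|]; exact: bigsetU_measurable.
by rewrite lerD2l.
Qed.

Hypothesis Xstd : standard_borel R X.

Definition eqset s t : set X := [set x | [/\ pdom s x, pdom t x & pf s x = pf t x]].

(** A measurable injection of [X] into the reals turns the coincidence set into one of two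
    measurable real functions. *)
Lemma measurable_eqset s t : measurable (eqset s t).
Proof.
case: Xstd => f [finj [mf _]].
have -> : eqset s t = (pdom s `&` pdom t) `&`
    (fun x => f (pf s x) == f (pf t x)) @^-1` [set true].
  apply/seteqP; split=> x /=; first by case=> ? ? ->; rewrite eqxx.
  by move=> [[? ?] /eqP/finj].
have mI : measurable (pdom s `&` pdom t) by apply: measurableI; exact: pdom_m.
apply: (measurable_realfun.measurable_fun_eqr (f := f \o pf s) (g := f \o pf t)) => //.
  apply: (measurable_comp (F := setT)) => //.
  by apply: measurable_funS (@pf_m _ _ s) => //; exact: pdom_m.
apply: (measurable_comp (F := setT)) => //.
by apply: measurable_funS (@pf_m _ _ t) => //; exact: pdom_m.
Qed.

Definition diffset s t : set X := [set x | (pdom s x \/ pdom t x) /\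
              ~ [/\ pdom s x, pdom t x & pf s x = pf t x]].

Lemma measurable_diffset s t : measurable (diffset s t).
Proof.
have -> : diffset s t = (pdom s `|` pdom t) `\` eqset s t by [].
apply: measurableD; last exact: measurable_eqset.
by apply: measurableU; exact: pdom_m.
Qed.

Definition fixset s : set X := [set x | pdom s x /\ pf s x = x].

Lemma measurable_fixset s : measurable (fixset s).
Proof.
have -> : fixset s = eqset s (pid X) by apply/seteqP; split=> x /=; case.
exact: measurable_eqset.
Qed.

Definition rdist s t : R := mreal (diffset s t).

Lemma udistE s t : udist mu s t = (rdist s t)%:E.
Proof. by rewrite -mrealE//; exact: measurable_diffset. Qed.

Lemma rdist_triangle t s u : rdist s u <= rdist s t + rdist t u.
Proof.
apply: mreal_leU; try exact: measurable_diffset.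
move=> x [su nsu]; apply: contrapT => /not_orP[nst ntu].
have st : ptwise_eq s t x by move=> h; apply: contrapT => k; apply: nst.
have tu : ptwise_eq t u x by move=> h; apply: contrapT => k; apply: ntu.
apply: nsu; case: su => h.
  by case: (st (or_introl h)) => sx tx ->; case: (tu (or_introl tx)).
by case: (tu (or_intror h)) => tx ux <-; case: (st (or_intror tx)).
Qed.

Lemma rdistC s t : rdist s t = rdist t s.
Proof.
congr mreal; apply/seteqP; split=> x [st nst]; split; try tauto;
  by move=> [? ? ?]; apply: nst.
Qed.

Lemma rdist_ae_eq s t : ae_eq mu s t -> rdist s t = 0.
Proof.
move=> /ae_eqP st; apply/eqP; rewrite eq_le mreal_ge0 andbT -mreal0.
apply: mreal_le_ae => //; first exact: measurable_diffset.
by apply: filterS st => x st [h] /(_ (st h)).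
Qed.

Lemma tau_rdist s t : mreal (fixset s) <= mreal (fixset t) + rdist s t.
Proof.
apply: mreal_leU; [exact: measurable_fixset..|exact: measurable_diffset|].
move=> x [sx sxx]; case: (pselect (fixset t x)); [by left|right; split; first by left].
by move=> [_ tx E]; apply: b; rewrite /fixset /= -E.
Qed.

Lemma pdom_rdist s t : mreal (pdom s) <= mreal (eqset s t) + rdist s t.
Proof.
apply: mreal_leU; [exact: pdom_m|exact: measurable_eqset|exact: measurable_diffset|].
by move=> x sx; case: (pselect (eqset s t x)) => h; [left|right; split=> //; left].
Qed.

End AlmostEverywhere.

(** * Orthogonal sums of words: products, inverses, finiteness *)

Section Sums.
Context (R : realType) (d : measure_display) (X : measurableType d)
  (mu : probability X R).
Implicit Types (s t u v p q : pbij X) (F : seq (pbij X)).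

(** The last clause is disjointness of the domains, seen at [x]. *)
Definition sum_at (I : finType) (w : I -> pbij X) t x :=
  [/\ pdom t x <-> exists i, pdom (w i) x,
      forall i, pdom (w i) x -> pf t x = pf (w i) x &
      forall i j, pdom (w i) x -> pdom (w j) x -> i = j].

Lemma foldr_pdom (L : seq (pbij X)) x :
  foldr (fun s A => pdom s `|` A) set0 L x <->
  exists i : 'I_(size L), pdom (nth (pid X) L i) x.
Proof.
elim: L => [|s L IH] /=; first by split=> // -[[]].
split=> [[sx|/IH[i xi]]|[[[|i] /= iL] xi]].
- by exists ord0.
- by exists (lift ord0 i).
- by left.
- by right; apply/IH; exists (Ordinal (iL : (i < size L)%N)).
Qed.

Lemma nth_In (L : seq (pbij X)) n : (n < size L)%N -> List.In (nth (pid X) L n) L.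
Proof.
elim: L n => [//|s L IH] [|n] /=; first by left.
by rewrite ltnS => /IH; right.
Qed.

Lemma In_nthP (L : seq (pbij X)) p : List.In p L ->
  exists2 n, (n < size L)%N & nth (pid X) L n = p.
Proof.
elim: L => [//|s L IH] /= [->|/IH[n nL E]]; first by exists 0%N.
by exists n.+1.
Qed.

Lemma orth_list_nth (L : seq (pbij X)) x (i j : nat) : orth_list L ->
  (i < size L)%N -> (j < size L)%N ->
  pdom (nth (pid X) L i) x -> pdom (nth (pid X) L j) x -> i = j.
Proof.
elim: L i j => [//|s L IH] i j /= [H oL].
have K n : (n < size L)%N -> pdom s x -> pdom (nth (pid X) L n) x -> False.
  move=> /nth_In/H[+ _] sx nx; rewrite -subset0.
  by move=> /(_ x); apply.
case: i j => [|i] [|j] //=; rewrite ?ltnS => iL jL xi xj.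
- by case: (K j).
- by case: (K i).
- by congr S; exact: IH.
Qed.

Lemma orth_list_map (I : eqType) (w : I -> pbij X) (r : seq I) : uniq r ->
  (forall i j, i != j ->
     pdom (w i) `&` pdom (w j) = set0 /\ pran (w i) `&` pran (w j) = set0) ->
  orth_list [seq w i | i <- r].
Proof.
move=> + H; elim: r => [//|a r IH] /= /andP[ar ur]; split; last exact: IH.
move=> u; elim: r ar {IH ur} => [//|b r IH]; rewrite inE negb_or => /andP[ab ar] /=.
by case=> [<-|]; [exact: H|exact: IH].
Qed.

Lemma In_map_enum (I : finType) (w : I -> pbij X) u :
  List.In u [seq w i | i <- enum I] -> exists i, u = w i.
Proof. by elim: (enum I) => [//|a r IH] /= [<-|//]; exists a. Qed.

(* Sums of elements a.e. equal to words, in terms of the words themselves: no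
   condition on ranges is needed, since [t] is injective. *)
Lemma SigFP F n t : SigF mu F n t <->
  exists (I : finType) (w : I -> pbij X),
    (forall i, FPn F n (w i)) /\ \forall x \ae mu, sum_at w t x.
Proof.
split=> [[L [HL oL [t' [[dt' ft'] /ae_eqP tt']]]]|[I [w [Hw /aeP[N [mN N0 H]]]]]].
  have ex (i : 'I_(size L)) : {p | FPn F n p /\ ae_eq mu (nth (pid X) L i) p}.
    by apply: cid; apply: HL; exact: nth_In.
  exists 'I_(size L), (fun i => sval (ex i)); split; first by move=> i; case: (svalP (ex i)).
  have : \forall x \ae mu, forall i : 'I_(size L), ptwise_eq (nth (pid X) L i) (sval (ex i)) x.
    by apply: filter_forall => i; apply/ae_eqP; case: (svalP (ex i)).
  apply: filterS2 tt' => x tt' Hx.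
  have domE (i : 'I_(size L)) : pdom (sval (ex i)) x <-> pdom (nth (pid X) L i) x.
    by split=> h; [case: (Hx i (or_intror h))|case: (Hx i (or_introl h))].
  have tE : pdom t x <-> pdom t' x.
    by split=> h; [case: (tt' (or_introl h))|case: (tt' (or_intror h))].
  split.
  - rewrite tE dt' foldr_pdom; split=> -[i /domE xi]; exists i => //.
  - move=> i xi; have /domE xi' := xi.
    have t'x : pdom t' x by rewrite dt' foldr_pdom; exists i.
    have [_ _ ->] := tt' (or_intror t'x).
    have [_ _ <-] := Hx i (or_introl xi').
    by apply: ft' => //; exact: nth_In.
  - move=> i j /domE xi /domE xj; apply: val_inj => /=.
    exact: orth_list_nth oL _ _ xi xj.
(* [orth_list] asks for disjointness everywhere, so every word is restricted to the complement of
   the exceptional null set. *)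
have mC : measurable (~` N) by exact: measurableC.
pose c := pidon mC.
have aec p : ae_eq mu (pmul p c) p.
  exists N; split=> // x; rewrite /= /preimage /= => -[[Nx px]|px] h; split=> //.
exists [seq pmul (w i) c | i <- enum I]; split.
- by move=> s /In_map_enum[i ->]; exists (w i).
- apply: orth_list_map; first exact: enum_uniq.
  move=> i j ij; split; apply/seteqP; split=> // x /=; rewrite /preimage /=.
    move=> [[Nx xi] [_ xj]]; move/eqP: ij; apply.
    by case: (H _ Nx) => _ _; exact.
  (* A common image of two words has preimages under both, which [t] sends to the same point;
     injectivity of [t] identifies them, and the domains are disjoint. *)
  move=> [[ri Ni] [rj Nj]]; move/eqP: ij; apply.
  have [di fi _] := H _ Ni; have [dj fj u] := H _ Nj.
  have xi := pg_dom ri; have xj := pg_dom rj.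
  have E : pg (w i) x = pg (w j) x.
    have ti : pdom t (pg (w i) x) by apply/di; exists i.
    have tj : pdom t (pg (w j) x) by apply/dj; exists j.
    rewrite -(pgf ti) -(pgf tj); congr pg.
    by rewrite (fi i)// (fj j)// !pfg.
  by apply: u => //; rewrite -E.
exists (pmul t c); split; last exact/ae_eq_sym/aec.
split.
  apply/seteqP; split=> x.
    rewrite /= /preimage /= => -[Nx tx].
    have [dt _ _] := H _ Nx; have /dt[i xi] := tx; apply/foldr_pdom.
    have iI : (index i (enum I) < size [seq pmul (w i) c | i <- enum I])%N.
      by rewrite size_map index_mem mem_enum.
    exists (Ordinal iI) => /=; rewrite (nth_map i); last by rewrite index_mem mem_enum.
    by rewrite nth_index ?mem_enum.
  move=> /foldr_pdom[i]; have /In_map_enum[j ->] := nth_In (ltn_ord i).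
  rewrite /= /preimage /= => -[Nx xj]; split=> //.
  by have [dt _ _] := H _ Nx; apply/dt; exists j.
move=> s /In_map_enum[i ->] x; rewrite /= /preimage /= => -[Nx xi].
by have [_ fi _] := H _ Nx; exact: fi.
Qed.

Lemma SigF_ae_eq F n s t : ae_eq mu s t -> SigF mu F n s -> SigF mu F n t.
Proof.
move=> st [L [HL oL [t' [sL st']]]]; exists L; split=> //; exists t'; split=> //.
exact: ae_eq_trans (ae_eq_sym st) st'.
Qed.

Lemma SigF_mono F n m s : (n <= m)%N -> SigF mu F n s -> SigF mu F m s.
Proof.
move=> nm /SigFP[I [w [Hw H]]]; apply/SigFP; exists I, w; split=> // i.
exact: FPn_mono (Hw i).
Qed.

Lemma SigF_FPn F n p : FPn F n p -> SigF mu F n p.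
Proof.
move=> Fp; apply/SigFP; exists unit, (fun=> p); split=> //; apply: nearW => x.
by split=> // [|[] []//]; split=> [|[]//]; exists tt.
Qed.

(** Up to a null set a sum is determined by the set of words occurring in it, since it coincides
    with each of them on its domain. The code is such a set, and there are finitely many words of
    length [n]. *)
Lemma SigF_ae_finite F n : exists (C : finType) (code : pbij X -> C),
  forall s t, SigF mu F n s -> SigF mu F n t -> code s = code t -> ae_eq mu s t.
Proof.
have [W HW] := FPn_finite F n.
pose rep s : set {set 'I_(size W)} := fun A => exists (I : finType) (w : I -> pbij X),
  (\forall x \ae mu, sum_at w s x) /\
  (forall p, (exists i, p = w i) <-> exists k : 'I_(size W), k \in A /\ p = nth (pid X) W k).
have exrep s : SigF mu F n s -> exists A, rep s A.
  move=> /SigFP[I [w [Hw H]]].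
  exists [set k : 'I_(size W) | `[< exists i, nth (pid X) W k = w i >]]%SET, I, w.
  split=> // p; split=> [[i pi]|[k []]]; last first.
    by rewrite inE => /asboolP[i wi] ->; exists i.
  have : List.In p W by apply: HW; rewrite pi.
  case/In_nthP => k kW E.
  exists (Ordinal kW); split=> //; rewrite inE; apply/asboolP; exists i.
  by rewrite /= E.
(* A sum may have several representing sets, and [xget] fixes one; the default can only concern
   elements outside Sigma F_pm^n. *)
exists {set 'I_(size W)}, (fun s => xget finset.set0 (rep s)) => s t Ss St E.
have [I [w [Hw Iw]]] := xgetPex finset.set0 (exrep s Ss).
have := xgetPex finset.set0 (exrep t St); rewrite -E => -[J [v [Hv Jv]]].
have IJ i : exists j, w i = v j by apply/Jv/Iw; exists i.
have JI j : exists i, v j = w i by apply/Iw/Jv; exists j.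
apply/ae_eqP; apply: filterS2 Hw Hv => x [ds fs us] [dt ft ut].
have K i j : w i = v j -> pdom (w i) x -> [/\ pdom s x, pdom t x & pf s x = pf t x].
  move=> E' xi; have xj : pdom (v j) x by rewrite -E'.
  split; [by apply/ds; exists i|by apply/dt; exists j|].
  by rewrite (fs i)// (ft j)// E'.
case=> [/ds[i xi]|/dt[j xj]].
  by have [j E'] := IJ i; exact: K E' xi.
by have [i E'] := JI j; apply: (K i j); rewrite -?E'.
Qed.

Context (Rel : X -> X -> Prop).
Hypothesis RelE : countable_borel_equiv Rel.
Hypothesis Rpmp : pmp mu Rel.

Lemma preim_pbij_measurable t B : measurable B -> measurable (pdom t `&` pf t @^-1` B).
Proof. by move=> mB; apply: pf_m => //; exact: pdom_m. Qed.

(** Restricting the range of [t] to [B] gives an element whose domain is the preimage and whose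
    range lies in [B]; invariance of the measure compares the two. *)
Lemma inR_preim t B : inR Rel t -> measurable B ->
  mreal mu (pdom t `&` pf t @^-1` B) <= mreal mu B.
Proof.
move=> Rt mB; pose c := pmul (pidon mB) t.
have -> : pdom t `&` pf t @^-1` B = pdom c by [].
have Rc : inR Rel c by move=> x /= [tx _]; exact: Rt.
rewrite /mreal (Rpmp Rc); apply: mreal_le => //; first exact: pran_m.
by move=> x [].
Qed.

Lemma ae_preim t (P : set X) : inR Rel t -> (\forall x \ae mu, P x) ->
  \forall x \ae mu, pdom t x -> P (pf t x).
Proof.
move=> Rt /aeP[N [mN N0 H]]; apply/aeP; exists (pdom t `&` pf t @^-1` N).
have mT := preim_pbij_measurable t mN; split=> //; last first.
  by move=> x nx tx; apply: H => Nx; apply: nx.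
rewrite mrealE//; congr _%:E; apply/eqP; rewrite eq_le mreal_ge0 andbT.
by apply: le_trans (inR_preim Rt mN) _; rewrite /mreal N0.
Qed.

Lemma inR_FPn_preim F n p (P : set X) : (forall s, List.In s F -> inR Rel s) ->
  FPn F n p -> (\forall x \ae mu, P x) -> \forall x \ae mu, pdom p x -> P (pf p x).
Proof. by move=> FR Fp; apply: ae_preim; exact: inR_FPn Fp. Qed.

(** Products distribute over sums. The description of [s] is needed at the points [pf (v j) x], and
    invariance of the measure keeps the pulled-back exceptional set null. *)
Lemma SigF_mul F n m s t : (forall s, List.In s F -> inR Rel s) ->
  SigF mu F n s -> SigF mu F m t -> SigF mu F (n + m) (pmul s t).
Proof.
move=> FR /SigFP[I [w [Hw Hs]]] /SigFP[J [v [Hv Ht]]]; apply/SigFP.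
exists (I * J)%type, (fun ij => pmul (w ij.1) (v ij.2)); split.
  by move=> [i j] /=; exact: FPn_mul.
have : \forall x \ae mu, forall j, pdom (v j) x -> sum_at w s (pf (v j) x).
  by apply: filter_forall => j; exact: inR_FPn_preim (Hv j) Hs.
apply: filterS2 Ht => x [dt ft ut] Hx; split.
- rewrite /= /preimage /=; split=> [[/dt[j xj]]|[[i j] /= [xj xi]]].
    rewrite (ft j)// => sx; have [ds _ _] := Hx j xj.
    by have /ds[i xi] := sx; exists (i, j).
  split; first by apply/dt; exists j.
  by rewrite (ft j)//; have [ds _ _] := Hx j xj; apply/ds; exists i.
- move=> [i j] /=; rewrite /preimage /= => -[xj xi]; rewrite (ft j)//.
  by have [_ fs _] := Hx j xj; exact: fs.
- move=> [i j] [i' j'] /=; rewrite /preimage /= => -[xj xi] [xj' xi'].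
  have E := ut _ _ xj xj'; subst j'; congr pair.
  by have [_ _ us] := Hx j xj; exact: us.
Qed.

(** The inverse of a sum is the sum of the inverses. The description of [t] is pulled back both
    along [pinv t] and along each [pinv (w i)]. *)
Lemma SigF_inv F n t : (forall s, List.In s F -> inR Rel s) -> inR Rel t ->
  SigF mu F n t -> SigF mu F n (pinv t).
Proof.
move=> FR Rt /SigFP[I [w [Hw H]]]; apply/SigFP; exists I, (fun i => pinv (w i)).
split; first by move=> i; exact: FPn_inv.
have H1 := ae_preim (inR_inv RelE Rt) H.
have : \forall y \ae mu, forall i, pran (w i) y -> sum_at w t (pg (w i) y).
  by apply: filter_forall => i; exact: (inR_FPn_preim FR (FPn_inv (Hw i)) H).
apply: filterS2 H1 => y /= Ht Hi.
have K i : pran (w i) y -> pran t y /\ pg t y = pg (w i) y.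
  move=> yi; have [dt ft _] := Hi i yi; have xi := pg_dom yi.
  have tx : pdom t (pg (w i) y) by apply/dt; exists i.
  have E : pf t (pg (w i) y) = y by rewrite (ft i)// pfg.
  by split; [rewrite -E; exact: pf_ran|rewrite -{1}E pgf].
split=> /=.
- split=> [ty|[i /K[]//]]; have [dt ft _] := Ht ty.
  have tx := pg_dom ty; have /dt[i xi] := tx; exists i.
  by rewrite -(pfg ty) (ft i)//; exact: pf_ran.
- by move=> i /K[].
- move=> i j yi yj; have [ty Ei] := K i yi; have [_ Ej] := K j yj.
  have [_ _ u] := Ht ty; apply: u; first by rewrite Ei; exact: pg_dom.
  by rewrite Ej; exact: pg_dom.
Qed.

(** Membership in [SigF] is up to null sets, so it gives [inR] only after discarding one. *)
Lemma SigF_inR_rep F n t : (forall s, List.In s F -> inR Rel s) ->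
  SigF mu F n t -> exists t', inR Rel t' /\ ae_eq mu t t'.
Proof.
move=> FR /SigFP[I [w [Hw /aeP[N [mN N0 H]]]]].
have mC : measurable (~` N) by exact: measurableC.
exists (pmul t (pidon mC)); split.
  move=> x /=; rewrite /preimage /= => -[Nx tx].
  have [dt ft _] := H _ Nx; have /dt[i xi] := tx.
  by rewrite (ft i)//; exact: inR_FPn (Hw i) _ _.
exists N; split=> // x; rewrite /= /preimage /= => -[px|[? px]] h; split=> //.
Qed.

Hypothesis Xstd : standard_borel R X.

(** Where [t] and [t'] coincide, the products can differ only on the preimage under [t'] of
    [diffset s s']. *)
Lemma rdist_mul s s' t t' : inR Rel t' ->
  rdist mu (pmul s t) (pmul s' t') <= rdist mu s s' + rdist mu t t'.
Proof.
move=> Rt; have mD := measurable_diffset Xstd.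
have := inR_preim Rt (mD s s'); rewrite -(lerD2r (rdist mu t t')); apply: le_trans.
apply: mreal_leU; [exact: mD|exact: preim_pbij_measurable|exact: mD|].
move=> x Dx; case: (pselect (diffset t t' x)) => [|nt]; [by right|left].
have tt : ptwise_eq t t' x by move=> h; apply: contrapT => k; apply: nt.
have tx' : pdom t' x.
  case: Dx => -[] /= [h _] _; last by [].
  by case: (tt (or_introl h)).
have [tx _ E] := tt (or_intror tx').
split=> //; move: Dx; rewrite /diffset /= /preimage /= E => -[dd nn]; split; first tauto.
by move=> [? ? E']; apply: nn.
Qed.

End Sums.

(** * Metric estimates for a single microstate *)

Section Microstates.
Context (R : realType) (d : measure_display) (X : measurableType d)
  (mu : probability X R) (Rel : X -> X -> Prop).
Hypothesis Xstd : standard_borel R X.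
Hypothesis RelE : countable_borel_equiv Rel.
Hypothesis Rpmp : pmp mu Rel.
Context (F : seq (pbij X)).
Hypothesis FR : forall s, List.In s F -> inR Rel s.

Section OneMicrostate.
Context (n D : nat) (delta : R) (phi : pbij X -> pperm D).
Hypothesis phiSA : SA mu F n delta phi.
Implicit Types (a b s t : pbij X).
Local Notation v a := (val (phi a)).

Lemma SA_ae_eq s t : ae_eq mu s t -> v s = v t.
Proof. by case: phiSA => H _ _ _ /H ->. Qed.

Lemma SA_mul k l s t : (k + l <= n)%N -> SigF mu F k s -> SigF mu F l t ->
  pp_dist R (v (pmul s t)) (pp_mul (v s) (v t)) <= delta.
Proof.
move=> kl Ss St; case: phiSA => _ _ H _; apply/ltW/H.
- by apply: SigF_mono Ss; apply: leq_trans kl; exact: leq_addr.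
- by apply: SigF_mono St; apply: leq_trans kl; exact: leq_addl.
- by apply: SigF_mono kl _; exact: (SigF_mul RelE Rpmp).
Qed.

Lemma SA_tr s : SigF mu F n s -> `|pp_tr R (v s) - mreal mu (fixset s)| <= delta.
Proof. by case: phiSA => _ _ _ H /H/ltW. Qed.

Lemma dens_nonret_inv k b : (k + k <= n)%N -> inR Rel b -> SigF mu F k b ->
  dens R (nonret (v b) (v (pinv b))) <= 2 * delta.
Proof.
move=> kn Rb Sb; have Sb' := SigF_inv RelE Rpmp FR Rb Sb.
apply: (@dens_nonret _ _ _ _ _ (v (pmul (pinv b) b))); first exact: valP.
  exact: SA_mul Sb' Sb.
(* As a triple product this would have length [3 * k], but it equals [b] and so already lies in
   Sigma F_pm^k; hence [k + k <= n] suffices. *)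
have E : ae_eq mu b (pmul b (pmul (pinv b) b)).
  apply/ae_eqP/nearW => x; rewrite /ptwise_eq /= /preimage /= => h.
  have bx : pdom b x by case: h => [//|[[]]].
  have ? := pf_ran bx.
  by split=> //; rewrite ?pgf.
rewrite {1}(SA_ae_eq E); case: phiSA => _ _ H _; apply/ltW/H.
- by apply: SigF_mono Sb; apply: leq_trans kn; exact: leq_addr.
- by apply: SigF_mono kn _; exact: (SigF_mul RelE Rpmp).
- apply: SigF_ae_eq E _; apply: SigF_mono Sb; apply: leq_trans kn; exact: leq_addr.
Qed.

Lemma dens_nonret_inv' k b : (k + k <= n)%N -> inR Rel b -> SigF mu F k b ->
  dens R (nonret (v (pinv b)) (v b)) <= 2 * delta.
Proof.
move=> kn Rb Sb; rewrite -{2}(pinvK b); apply: (dens_nonret_inv kn).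
  exact: inR_inv.
exact: (SigF_inv RelE Rpmp).
Qed.

(** The trace of a^-1 a is the measure of the domain of [a]. The error is [delta] for the trace,
    [delta] for the product and [2 * delta] for [nonret]. *)
Lemma dens_ppdom_SA k a : (k + k <= n)%N -> inR Rel a -> SigF mu F k a ->
  dens R (ppdom (v a)) <= mreal mu (pdom a) + 4 * delta.
Proof.
move=> kn Ra Sa; have Sa' := SigF_inv RelE Rpmp FR Ra Sa.
have /dens_ppdom_le := SA_mul kn Sa' Sa.
have := dens_nonret_inv kn Ra Sa.
have := SA_tr (SigF_mono kn (SigF_mul RelE Rpmp FR Sa' Sa)); rewrite ler_norml.
have -> : fixset (pmul (pinv a) a) = pdom a.
  apply/seteqP; split=> x; rewrite /fixset /= /preimage /=; first by case=> -[].
  by move=> ax; have ? := pf_ran ax; rewrite pgf.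
lra.
Qed.

(** The fixed points of b^-1 a are exactly the points where [a] and [b] agree. *)
Lemma dens_agree_SA k a b : (k + k <= n)%N -> inR Rel b ->
  SigF mu F k a -> SigF mu F k b ->
  mreal mu (eqset a b) - 4 * delta <= dens R (agree (v a) (v b)).
Proof.
move=> kn Rb Sa Sb; have Sb' := SigF_inv RelE Rpmp FR Rb Sb.
have /(dens_agree_ge (v b) (valP (phi a))) := SA_mul kn Sb' Sa.
have := dens_nonret_inv' kn Rb Sb.
have := SA_tr (SigF_mono kn (SigF_mul RelE Rpmp FR Sb' Sa)); rewrite ler_norml.
have -> : fixset (pmul (pinv b) a) = eqset a b.
  apply/seteqP; split=> x; rewrite /fixset /eqset /= /preimage /=.
    move=> [[ax bax] E]; split=> //; first by rewrite -E; exact: pg_dom.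
    by rewrite -{2}E pfg.
  move=> [ax bx ->]; have ? := pf_ran bx; by rewrite pgf.
lra.
Qed.

(** Trace of (a^-1 a)(b^-1 b), a product of four elements of length [k]. *)
Lemma dens_ppdomI_SA k a b : (4 * k <= n)%N -> inR Rel a -> inR Rel b ->
  SigF mu F k a -> SigF mu F k b ->
  dens R (ppdom (v a) :&: ppdom (v b)) <= mreal mu (pdom a `&` pdom b) + 8 * delta.
Proof.
move=> kn4 Ra Rb Sa Sb; have kn : (k + k <= n)%N by lia.
have Sa' := SigF_inv RelE Rpmp FR Ra Sa; have Sb' := SigF_inv RelE Rpmp FR Rb Sb.
have Saa := SigF_mul RelE Rpmp FR Sa' Sa; have Sbb := SigF_mul RelE Rpmp FR Sb' Sb.
have kn' : (k + k + (k + k) <= n)%N by lia.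
have := dens_ppdomI_le (SA_mul kn Sa' Sa) (SA_mul kn Sb' Sb)
  (valP (phi _)) (SA_mul kn' Saa Sbb).
have := dens_nonret_inv kn Ra Sa; have := dens_nonret_inv kn Rb Sb.
have := SA_tr (SigF_mono kn' (SigF_mul RelE Rpmp FR Saa Sbb)); rewrite ler_norml.
set c := pmul (pmul _ _) _.
have : mreal mu (fixset c) <= mreal mu (pdom a `&` pdom b).
  apply: mreal_le; first exact: (measurable_fixset Xstd).
    by apply: measurableI; exact: pdom_m.
  move=> x; rewrite /fixset /c /= /preimage /= => -[[[bx _] []]].
  by rewrite pgf.
lra.
Qed.

(** The Lipschitz bound. Each domain exceeds the agreement set by at most [rdist mu a b]; the two
    domains and twice the agreement set each carry an error of [4 * delta]. *)
Lemma pp_dist_SA k a b : (k + k <= n)%N -> inR Rel a -> inR Rel b ->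
  SigF mu F k a -> SigF mu F k b ->
  pp_dist R (v a) (v b) <= 2 * rdist mu a b + 16 * delta.
Proof.
move=> kn Ra Rb Sa Sb.
have := pp_dist_le_agree R (v a) (v b).
have := dens_agree_SA kn Rb Sa Sb.
have := dens_ppdom_SA kn Ra Sa; have := dens_ppdom_SA kn Rb Sb.
have := pdom_rdist mu Xstd a b; have := pdom_rdist mu Xstd b a.
have -> : eqset b a = eqset a b by apply/seteqP; split=> x [? ? ?].
rewrite (rdistC mu b a); lra.
Qed.

End OneMicrostate.

Lemma map_eq_In (T U : Type) (f g : T -> U) (s : seq T) x :
  map f s = map g s -> List.In x s -> f x = g x.
Proof. by elim: s => [//|y s IH] /= [E1 /IH E2] [<-|]. Qed.

(** * Comparison of two microstates with the same restriction to F *)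

Section TwoMicrostates.
Context (n D : nat) (delta : R) (phi1 phi2 : pbij X -> pperm D).
Hypothesis delta0 : 0 < delta.
Hypothesis phi1SA : SA mu F n delta phi1.
Hypothesis phi2SA : SA mu F n delta phi2.
Hypothesis phiE : [seq phi1 s | s <- F] = [seq phi2 s | s <- F].
Hypothesis n2 : (2 <= n)%N.

(** For [f] in [F], the two images of [pinv f] are almost inverse to the same partial permutation;
    the four defects are at most [2 * delta] each. *)
Lemma pp_dist_Fpm u : Fpm F u ->
  pp_dist R (val (phi1 u)) (val (phi2 u)) <= 8 * delta.
Proof.
have d0 (f : {ffun 'I_D -> option 'I_D}) : pp_dist R f f <= 8 * delta.
  rewrite pp_distE (_ : finset _ = finset.set0); last by apply/setP => i; rewrite !inE eqxx.
  by rewrite /dens cards0 mul0r mulr_ge0// ltW.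
case=> [Fu|[[f [Ff ->]]|->]].
- by rewrite (map_eq_In phiE Fu).
- have Sf : SigF mu F 1 f by apply/SigF_FPn/FPn_Fpm; left.
  have Rf := FR Ff; have n11 : (1 + 1 <= n)%N by [].

  have := dens_nonret_inv phi1SA n11 Rf Sf; have := dens_nonret_inv phi2SA n11 Rf Sf.
  have := dens_nonret_inv' phi1SA n11 Rf Sf; have := dens_nonret_inv' phi2SA n11 Rf Sf.
  rewrite (map_eq_In phiE Ff).
  have := pp_dist_quasi_inv R (val (phi2 f)) (valP (phi1 (pinv f))) (valP (phi2 (pinv f))).
  lra.
- by case: phi1SA => _ -> _ _; case: phi2SA => _ -> _ _.
Qed.

(** Each letter costs [8 * delta] for its own discrepancy and [delta] for the multiplicativity of
    each microstate. *)
Lemma pp_dist_FPn l w : (l <= n)%N -> FPn F l w ->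
  pp_dist R (val (phi1 w)) (val (phi2 w)) <= 10 * delta * l%:R.
Proof.
elim: l w => [|l IH] w ln /=.
  move=> ->; case: phi1SA => _ -> _ _; case: phi2SA => _ -> _ _.
  rewrite mulr0 pp_distE (_ : finset _ = finset.set0); last by apply/setP => i; rewrite !inE eqxx.
  by rewrite /dens cards0 mul0r.
move=> [u [v [Fu [Fv ->]]]]; have {}IH := IH v (ltnW ln) Fv.
have Su : SigF mu F 1 u by exact/SigF_FPn/FPn_Fpm.
have Sv : SigF mu F l v by exact/SigF_FPn.
have := pp_dist_Fpm Fu.
have ln' : (1 + l <= n)%N by [].
have := SA_mul phi1SA ln' Su Sv; have := SA_mul phi2SA ln' Su Sv.
have := pp_dist_triangle R (pp_mul (val (phi1 u)) (val (phi1 v)))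
  (val (phi1 (pmul u v))) (val (phi2 (pmul u v))).
have := pp_dist_triangle R (pp_mul (val (phi2 u)) (val (phi2 v)))
  (pp_mul (val (phi1 u)) (val (phi1 v))) (val (phi2 (pmul u v))).
have := pp_dist_triangle R (pp_mul (val (phi2 u)) (val (phi1 v)))
  (pp_mul (val (phi1 u)) (val (phi1 v))) (pp_mul (val (phi2 u)) (val (phi2 v))).
have := pp_dist_mulr R (val (phi1 u)) (val (phi2 u)) (valP (phi1 v)).
have := pp_dist_mull R (val (phi2 u)) (val (phi1 v)) (val (phi2 v)).
rewrite (pp_distC R (val (phi2 (pmul u v)))) -natr1; lra.
Qed.

Lemma dens_disagree_SigF l (I : finType) (w : I -> pbij X) t : (4 * l <= n)%N ->
  (forall i, FPn F l (w i)) -> (\forall x \ae mu, sum_at w t x) -> inR Rel t ->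
  dens R (ppdom (val (phi1 t)) :\: agree (val (phi1 t)) (val (phi2 t))) <=
    4 * delta + #|I|%:R * (4 * delta + 10 * delta * l%:R + 8 * delta)
    + (#|I| ^ 2)%:R * (8 * delta).
Proof.
move=> ln Hw Ht Rt.
have ln2 : (l + l <= n)%N by lia.
have ln1 : (l <= n)%N by lia.
have St : SigF mu F l t by apply/SigFP; exists I, w.
have Sw i : SigF mu F l (w i) by exact: SigF_FPn.
have Rw i : inR Rel (w i) by exact: inR_FPn FR (Hw i).
have mE := measurable_eqset Xstd.
have Ew i : mreal mu (pdom (w i)) <= mreal mu (eqset (w i) t).
  apply: mreal_le_ae; [exact: pdom_m|exact: mE|].
  apply: filterS Ht => x [dt ft _] xi; split=> //; last by rewrite (ft i).
  by apply/dt; exists i.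
(* The masses [m i] are the measures of the domains of the words, which add up to that of [t]. *)
apply: (dens_disagree_sum (W1 := fun i => val (phi1 (w i)))
  (W2 := fun i => val (phi2 (w i))) (m := fun i => mreal mu (pdom (w i)))).
- by rewrite mulr_ge0// ltW.
- apply: le_trans (dens_ppdom_SA phi1SA ln2 Rt St) _; rewrite lerD2r.
  apply: le_trans (_ : _ <= mreal mu (\big[setU/set0]_(i <- enum I) pdom (w i))) _.
    apply: mreal_le_ae; first exact: pdom_m.
      by apply: bigsetU_measurable => i _; exact: pdom_m.
    apply: filterS Ht => x [dt _ _] /dt[i xi].
    rewrite big_enum /= (bigD1 i)//=; by left.
  apply: le_trans (mreal_bigcup _ _ _) _; first by move=> i; exact: pdom_m.
  by rewrite big_enum.
- move=> i; apply: le_trans (dens_agree_SA phi1SA ln2 Rt (Sw i) St).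
  by rewrite lerD2r.
- move=> i j ij.
  apply: le_trans (dens_ppdomI_SA phi1SA ln (Rw i) (Rw j) (Sw i) (Sw j)) _.
  rewrite -[leRHS]add0r lerD2r -(mreal0 mu); apply: mreal_le_ae => //.
    by apply: measurableI; exact: pdom_m.
  apply: filterS Ht => x [_ _ u] [xi xj]; move/eqP: ij; apply; exact: u.
- by move=> i; exact: pp_dist_FPn.
- move=> i.
  have := dens_ppdom_SA phi2SA ln2 (Rw i) (Sw i).
  have := dens_agree_SA phi2SA ln2 Rt (Sw i) St.
  have := Ew i.
  set A := agree _ _; set B := ppdom _.
  have AB : A \subset B.
    by apply/fintype.subsetP => j; rewrite !inE => /andP[].
  rewrite (densBsub R AB).
  lra.
Qed.
End TwoMicrostates.

(** [C] depends on the chosen decomposition of [t] but not on [n], [D] or [delta], so [delta] can be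
    chosen after it. The factor 2 comes from exchanging the two microstates. *)
Lemma pp_dist_SigF l t : SigF mu F l t -> inR Rel t ->
  exists2 C : R, 0 <= C & forall n D delta (phi1 phi2 : pbij X -> pperm D),
    0 < delta -> (2 <= n)%N -> (4 * l <= n)%N ->
    SA mu F n delta phi1 -> SA mu F n delta phi2 ->
    [seq phi1 s | s <- F] = [seq phi2 s | s <- F] ->
    pp_dist R (val (phi1 t)) (val (phi2 t)) <= C * delta.
Proof.
move=> /SigFP[I [w [Hw Ht]]] Rt.
exists (2 * (4 + #|I|%:R * (12 + 10 * l%:R) + (#|I| ^ 2)%:R * 8)).
  by rewrite mulr_ge0// !addr_ge0// mulr_ge0// addr_ge0// mulr_ge0.
move=> n D delta phi1 phi2 d0 n2 ln S1 S2 E.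
have := dens_disagree_SigF d0 S1 S2 E n2 ln Hw Ht Rt.
have := dens_disagree_SigF d0 S2 S1 (esym E) n2 ln Hw Ht Rt.
have := pp_dist_le_disagree R (val (phi1 t)) (val (phi2 t)).
lra.
Qed.

End Microstates.

(** * Transfer of microstates from one generating set to another *)

Section Transfer.
Context (R : realType) (d : measure_display) (X : measurableType d)
  (mu : probability X R) (Rel : X -> X -> Prop).
Hypothesis Xstd : standard_borel R X.
Hypothesis RelE : countable_borel_equiv Rel.
Hypothesis Rpmp : pmp mu Rel.
Context (E F : seq (pbij X)).
Hypothesis ER : forall s, List.In s E -> inR Rel s.
Hypothesis FR : forall s, List.In s F -> inR Rel s.
Hypothesis Egen : dyn_gen mu Rel E.
Hypothesis Fgen : dyn_gen mu Rel F.

Lemma dyn_gen_inR G s (eps : R) : (forall u, List.In u G -> inR Rel u) ->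
  dyn_gen mu Rel G -> inR Rel s -> 0 < eps ->
  exists n t, [/\ SigF mu G n t, inR Rel t & rdist mu s t <= eps].
Proof.
move=> GR Ggen Rs eps0; have [n [t [St st]]] := Ggen s Rs eps eps0.
have [t' [Rt' tt']] := SigF_inR_rep RelE GR St.
exists n, t'; split=> //; first exact: SigF_ae_eq tt' St.
apply: le_trans (rdist_triangle mu Xstd t _ _) _.
rewrite (rdist_ae_eq Xstd tt') addr0 -lee_fin -udistE//.
exact: ltW.
Qed.

(** Elements of [L] are approximated by sums of words in [F], on which microstates are almost
    determined by their restriction to [F]. *)
Lemma determined_approx (L : seq (pbij X)) (eps : R) : 0 < eps ->
  (forall s, List.In s L -> inR Rel s) ->
  exists n1 (delta1 : R), 0 < delta1 /\
    forall n delta, (n1 <= n)%N -> 0 < delta -> delta <= delta1 ->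
    forall e, List.In e L -> exists u,
      [/\ SigF mu F n u, inR Rel u, rdist mu e u <= eps &
          forall D (psi1 psi2 : pbij X -> pperm D),
            SA mu F n delta psi1 -> SA mu F n delta psi2 ->
            [seq psi1 s | s <- F] = [seq psi2 s | s <- F] ->
            pp_dist R (val (psi1 u)) (val (psi2 u)) <= eps].
Proof.
move=> eps0; elim: L => [|e L IH] LR; first by exists 0%N, 1.
have [|n1 [delta1 [d10 H1]]] := IH; first by move=> s Ls; apply: LR; right.
have [l [u [Su Ru eu]]] := dyn_gen_inR FR Fgen (LR e (or_introl erefl)) eps0.
have [C C0 HC] := pp_dist_SigF Xstd RelE Rpmp FR Su Ru.
(* Dividing by [C + 1] covers the case [C = 0]. *)
exists (maxn n1 (maxn 2 (4 * l))), (Num.min delta1 (eps / (C + 1))).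
have C1 : 0 < C + 1 by rewrite ltr_wpDl.
split; first by rewrite lt_min d10 divr_gt0.
move=> n delta; rewrite !geq_max => /andP[n1n /andP[n2 ln]] d0.
rewrite le_min => /andP[dd1 dC] e' [<-|]; last exact: H1.
exists u; split=> //; first by apply: SigF_mono Su; lia.
move=> D psi1 psi2 S1 S2 E12.
apply: le_trans (HC _ _ _ _ _ d0 n2 ln S1 S2 E12) _.
move: dC; rewrite ler_pdivlMr// => dC; apply: le_trans dC.
by rewrite mulrC ler_pM2l// lerDl.
Qed.

(** There are finitely many classes modulo null sets, so the largest of finitely many lengths serves
    for all. *)
Lemma uniform_approx n (eps : R) : 0 < eps -> exists k, forall s, SigF mu F n s ->
  exists t, [/\ SigF mu E k t, inR Rel t & rdist mu s t <= eps].
Proof.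
move=> eps0; have [C [code Hcode]] := SigF_ae_finite mu F n.
have /choice[k Hk] (c : C) : exists k, forall s, SigF mu F n s -> code s = c ->
    exists t, [/\ SigF mu E k t, inR Rel t & rdist mu s t <= eps].
  case: (pselect (exists s, SigF mu F n s /\ code s = c)) => [[s [Ss sc]]|nex]; last first.
    by exists 0%N => s Ss sc; case: nex; exists s.
  have [s' [Rs' ss']] := SigF_inR_rep RelE FR Ss.
  have [k [t [St Rt st]]] := dyn_gen_inR ER Egen Rs' eps0.
  exists k => s1 Ss1 s1c; exists t; split=> //.
  have s1s' : ae_eq mu s1 s' by apply: ae_eq_trans ss'; apply: Hcode => //; rewrite sc.
  apply: le_trans (rdist_triangle mu Xstd s' _ _) _.
  by rewrite (rdist_ae_eq Xstd s1s') add0r.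
exists (\max_c k c)%N => s Ss; have [t [St Rt st]] := Hk (code s) s Ss erefl.
by exists t; split=> //; apply: SigF_mono St; exact: leq_bigmax.
Qed.

(** The choice depends on the set [P] alone, so equal sets give the same element. *)
Definition choose_pbij (P : set (pbij X)) : pbij X :=
  if pselect (exists s, P s) is left h then sval (cid h) else pid X.

Lemma choose_pbijP (P : set (pbij X)) : (exists s, P s) -> P (choose_pbij P).
Proof. by rewrite /choose_pbij; case: pselect => // h _; case: (cid h). Qed.

Lemma rdist_ae_eql s t u : ae_eq mu s t -> rdist mu s u = rdist mu t u.
Proof.
move=> st; apply/eqP; rewrite eq_le.
have := rdist_triangle mu Xstd t s u; have := rdist_triangle mu Xstd s t u.
rewrite (rdist_ae_eq Xstd st) (rdist_ae_eq Xstd (ae_eq_sym st)).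
by rewrite !add0r => -> ->.
Qed.

(** For [phi \o c] to be a microstate, [c] has to respect null sets and fix the identity exactly;
    the last clause of [P] secures the latter. *)
Lemma approx_choice n (eps : R) : 0 < eps -> exists k (c : pbij X -> pbij X),
  [/\ forall s t, ae_eq mu s t -> c s = c t, c (pid X) = pid X &
      forall s, SigF mu F n s ->
        [/\ SigF mu E k (c s), inR Rel (c s) & rdist mu s (c s) <= eps]].
Proof.
move=> eps0; have [k Hk] := uniform_approx n eps0.
pose P s : set (pbij X) := fun t => [/\ SigF mu E k t, inR Rel t, rdist mu s t <= eps &
  ae_eq mu s (pid X) -> t = pid X].
have exP s : SigF mu F n s -> exists t, P s t.
  case: (pselect (ae_eq mu s (pid X))) => s1 Ss.
    exists (pid X); split=> //; [exact/SigF_FPn/FPn1|exact: inR_id|].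
    by rewrite (rdist_ae_eq Xstd s1) ltW.
  by have [t [? ? ?]] := Hk s Ss; exists t; split.
exists k, (fun s => choose_pbij (P s)); split.
- move=> s t st; congr choose_pbij; apply/seteqP; split=> u [h1 h2 h3 h4]; split=> //.
  + by rewrite -(rdist_ae_eql u st).
  + by move=> t1; apply: h4; exact: ae_eq_trans t1.
  + by rewrite (rdist_ae_eql u st).
  + by move=> s1; apply: h4; apply: ae_eq_trans s1; exact: ae_eq_sym.
- have [|_ _ _] := choose_pbijP (exP (pid X) _); first exact/SigF_FPn/FPn1.
  by apply; exact: ae_eq_refl.
- by move=> s /exP/choose_pbijP[].
Qed.

(** The error budget when [c] has precision [g / 32] and [phi] has tolerance [g / 128]: in total
    [41 * g / 128]. *)
Lemma transfer_mul_arith (g delta ds dt z x y q r p : R) :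
  0 < g -> g <= delta -> ds <= g / 32 -> dt <= g / 32 -> z <= g / 32 ->
  x <= ds + dt -> y <= z + x -> q <= 2 * y + 16 * (g / 128) -> r <= g / 128 ->
  p <= q + r -> p < delta.
Proof. lra. Qed.

Lemma transfer_tr_arith (g delta ds a b t : R) :
  0 < g -> g <= delta -> ds <= g / 32 -> a <= b + ds -> b <= a + ds ->
  `|t - b| <= g / 128 -> `|t - a| < delta.
Proof. by move=> g0 gd h1 h2 h3; rewrite ler_norml ltr_norml; lra. Qed.

Lemma transfer_det_arith (g k eu uc x p1 p2 q a b : R) :
  0 < g -> g <= k -> eu <= k / 16 -> uc <= g / 32 -> x <= eu + uc ->
  p1 <= 2 * x + 16 * (g / 128) -> p2 <= 2 * x + 16 * (g / 128) -> q <= k / 16 ->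
  a <= p1 + b -> b <= q + p2 -> a <= k.
Proof. lra. Qed.

Lemma transfer n0 (delta0 kappa : R) : 0 < delta0 -> 0 < kappa ->
  exists m delta', 0 < delta' /\ exists c : pbij X -> pbij X, forall D,
    (forall phi : pbij X -> pperm D, SA mu E m delta' phi ->
       SA mu F n0 delta0 (phi \o c)) /\
    (forall phi1 phi2 : pbij X -> pperm D,
       SA mu E m delta' phi1 -> SA mu E m delta' phi2 ->
       [seq (phi1 \o c) s | s <- F] = [seq (phi2 \o c) s | s <- F] ->
       forall e, List.In e E -> pp_dist R (val (phi1 e)) (val (phi2 e)) <= kappa).
Proof.
move=> d00 k0.
have k16 : 0 < kappa / 16 by rewrite divr_gt0.
have [n1 [delta1 [d10 H1]]] := determined_approx k16 ER.
(* These parameters meet both the target and the requirement of [determined_approx]. *)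
pose n := maxn n0 n1; pose delta := Num.min delta0 delta1.
have delta_gt0 : 0 < delta by rewrite lt_min d00.
pose g := Num.min delta kappa; have g0 : 0 < g by rewrite lt_min delta_gt0.
have gd : g <= delta by rewrite ge_min lexx.
have gk : g <= kappa by rewrite ge_min lexx orbT.
have g32 : 0 < g / 32 by rewrite divr_gt0.
have [k [c [cae c1 Hc]]] := approx_choice n g32.
(* The Lipschitz bound is applied to [pmul (c s) (c t)], of length [k + k], which takes [4 * k];
   [1 <= K] puts [E] itself into Sigma E_pm^K. *)
pose K := maxn k 1; pose m := (4 * K)%N.
have kK : (k <= K)%N by rewrite leq_max leqnn.
exists m, (g / 128); split; first by rewrite divr_gt0.
exists c => D.
have SAn (phi : pbij X -> pperm D) : SA mu E m (g / 128) phi -> SA mu F n delta (phi \o c).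
  move=> Sphi; have [Sae S1 _ _] := Sphi; split=> /=.
  - by move=> s t /cae ->.
  - by rewrite c1.
  - move=> s t Ss St Sst.
    have [Es Rs ds] := Hc s Ss; have [Et Rt dt] := Hc t St; have [Est Rst dst] := Hc _ Sst.
    have m1 : (k + k <= m)%N by rewrite /m; clear -kK; lia.
    have m2 : (k + k + (k + k) <= m)%N by rewrite /m; clear -kK; lia.
    have Est' : SigF mu E (k + k) (c (pmul s t)) by apply: SigF_mono Est; exact: leq_addr.
    apply: (transfer_mul_arith g0 gd ds dt _ (rdist_mul Rpmp Xstd s (c s) t Rt)
      (rdist_triangle mu Xstd (pmul s t) (c (pmul s t)) (pmul (c s) (c t)))
      (pp_dist_SA Xstd RelE Rpmp ER Sphi m2 Rst (inR_mul RelE Rs Rt) Est'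
        (SigF_mul RelE Rpmp ER Es Et))
      (SA_mul RelE Rpmp ER Sphi m1 Es Et) (pp_dist_triangle _ _ _ _)).
    by rewrite rdistC.
  - move=> s Ss; have [Es Rs ds] := Hc s Ss.
    have km : (k <= m)%N by rewrite /m; clear -kK; lia.
    apply: (transfer_tr_arith g0 gd ds (tau_rdist mu Xstd s (c s)) _
      (SA_tr Sphi (SigF_mono km Es))).
    by rewrite rdistC; exact: tau_rdist.
split=> [phi /SAn [h1 h2 h3 h4]|phi1 phi2 S1 S2 E12 e Ee].
  have n0n : (n0 <= n)%N by rewrite leq_max leqnn.
  have dd0 : delta <= delta0 by rewrite ge_min lexx.
  split=> //.
    move=> s t Ss St Sst; apply: lt_le_trans dd0; apply: h3; exact: SigF_mono n0n _.
  by move=> s Ss; apply: lt_le_trans dd0; apply: h4; exact: SigF_mono n0n _.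
have n1n : (n1 <= n)%N by rewrite leq_max leqnn orbT.
have dd1 : delta <= delta1 by rewrite ge_min lexx orbT.
have [u [Su Ru eu Hu]] := H1 n delta n1n delta_gt0 dd1 e Ee.
have [Ecu Rcu dcu] := Hc u Su.
have m1 : (K + K <= m)%N by rewrite /m; clear -kK; lia.
have Se : SigF mu E K e.
  have : SigF mu E 1 e by apply/SigF_FPn/FPn_Fpm; left.
  by apply: SigF_mono; rewrite leq_max leqnn orbT.
have Scu := SigF_mono kK Ecu.
(* The chain is [phi1 e], [phi1 (c u)], [phi2 (c u)], [phi2 e]. The outer links are Lipschitz
   bounds; the middle one holds because the maps [phi1 \o c] and [phi2 \o c] are microstates on [F]
   with the same restriction. *)
apply: (transfer_det_arith g0 gk eu dcu (rdist_triangle mu Xstd u e (c u))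
  (pp_dist_SA Xstd RelE Rpmp ER S1 m1 (ER Ee) Rcu Se Scu)
  (pp_dist_SA Xstd RelE Rpmp ER S2 m1 (ER Ee) Rcu Se Scu)
  (Hu D _ _ (SAn _ S1) (SAn _ S2) E12)
  (pp_dist_triangle R _ (val (phi1 e)) (val (phi2 e)))).
by rewrite (pp_distC R (val (phi2 e))); exact: pp_dist_triangle.
Qed.

End Transfer.

(** * Counting restrictions of microstates *)

Section Counting.
Context (R : realType) (d : measure_display) (X : measurableType d)
  (mu : probability X R).

Definition restrictions (F : seq (pbij X)) n (delta : R) D : {set (size F).-tuple (pperm D)} :=
  [set t : (size F).-tuple (pperm D) |
    `[< exists phi, SA mu F n delta phi /\ [seq phi s | s <- F] = tval t >]]%SET.

Lemma NSAE F n delta D : NSA mu F n delta D = #|restrictions F n delta D|.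
Proof. by apply: eq_card => t; apply/idP/idP => /[!inE] /asboolP. Qed.

Lemma ppinj_one D : ppinj (pp_one D).
Proof.
by apply/forallP => i; apply/forallP => j; rewrite !ffunE; apply/implyP => /eqP[->].
Qed.

Lemma card_pair_sum (I J : finType) (P : I -> J -> bool) :
  #|[set p : I * J | P p.1 p.2]%SET| = (\sum_i #|[set j | P i j]%SET|)%N.
Proof.
rewrite -sum1_card (eq_bigl (fun p => true && P p.1 p.2)); last by move=> p; rewrite inE.
rewrite -(pair_big_dep xpredT P (fun _ _ => 1%N)) /=.
by apply: eq_bigr => i _; rewrite -sum1_card; apply: eq_bigl => j; rewrite inE.
Qed.

(** A tuple is read as one function on ['I_k * 'I_D] with [D.+1] possible values, and [T] lies in a
    Hamming ball around any of its members. *)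
Lemma card_tuple_ball D k (kappa : R) (T : {set k.-tuple (pperm D)}) :
  (0 < D)%N -> 0 <= kappa ->
  (forall t t', t \in T -> t' \in T -> forall i,
    pp_dist R (val (tnth t i)) (val (tnth t' i)) <= kappa) ->
  (#|T| <= 2 ^ (k * D) * D.+1 ^ Num.truncn (k%:R * (kappa * D%:R)))%N.
Proof.
move=> D0 k0 HT.
have [->|/set0Pn[t0 t0T]] := eqVneq T finset.set0; first by rewrite cards0.
pose g (t : k.-tuple (pperm D)) : {ffun 'I_k * 'I_D -> option 'I_D} :=
  [ffun p => val (tnth t p.1) p.2].
have ginj : injective g.
  move=> t t' /ffunP E; apply: eq_from_tnth => i; apply: val_inj; apply/ffunP => x.
  by have := E (i, x); rewrite !ffunE.
rewrite -(card_imset _ ginj).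
have := @card_hamming_ball _ _ (g t0) (Num.truncn (k%:R * (kappa * D%:R))) _.
rewrite card_prod card_option !card_ord => /(_ isT); apply: leq_trans.
apply/subset_leq_card/fintype.subsetP => _ /imsetP[t tT ->]; rewrite inE.
rewrite truncn_ge_nat; last by rewrite !mulr_ge0.
rewrite (_ : #|_| = (\sum_i #|[set x | val (tnth t0 i) x != val (tnth t i) x]%SET|)%N);
    last first.
  by rewrite -card_pair_sum; apply: eq_card => p; rewrite !inE !ffunE.
rewrite natr_sum; apply: le_trans (_ : _ <= \sum_(i < k) (kappa * D%:R)) _; last first.
  by rewrite sumr_const card_ord mulr_natl.
apply: ler_sum => i _; rewrite -ler_pdivrMr ?ltr0n//.
by have := HT t0 t t0T tT i; rewrite pp_distE.
Qed.

Context (E F : seq (pbij X)).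

(** Each restriction to [E] is lifted to a microstate and sent through [c] to a restriction to [F];
    the fibres of this map have diameter at most [kappa] in each coordinate. *)
Lemma NSA_transfer n0 m (delta0 delta' kappa : R) D (c : pbij X -> pbij X) :
  (0 < D)%N -> 0 <= kappa ->
  (forall phi : pbij X -> pperm D, SA mu E m delta' phi -> SA mu F n0 delta0 (phi \o c)) ->
  (forall phi1 phi2 : pbij X -> pperm D,
     SA mu E m delta' phi1 -> SA mu E m delta' phi2 ->
     [seq (phi1 \o c) s | s <- F] = [seq (phi2 \o c) s | s <- F] ->
     forall e, List.In e E -> pp_dist R (val (phi1 e)) (val (phi2 e)) <= kappa) ->
  (NSA mu E m delta' D <= NSA mu F n0 delta0 D *
    (2 ^ (size E * D) * D.+1 ^ Num.truncn ((size E)%:R * (kappa * D%:R))))%N.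
Proof.
move=> D0 k0 H1 H2; rewrite !NSAE.
set A := restrictions E _ _ _; set B := restrictions F _ _ _; set M := (_ * _ ^ _)%N.
pose phi0 : pbij X -> pperm D :=
  fun=> exist _ (pp_one D) (ppinj_one D).
pose lft (t : (size E).-tuple (pperm D)) := if pselect (exists phi, SA mu E m delta' phi /\ [seq phi s | s <- E] = tval t)
  is left h then sval (cid h) else phi0.
have lftP (t : (size E).-tuple (pperm D)) : t \in A ->
    SA mu E m delta' (lft t) /\ [seq lft t s | s <- E] = tval t.
  rewrite inE => /asboolP h; rewrite /lft; case: pselect => // h'.
  exact: (svalP (cid h')).
pose h (t : (size E).-tuple (pperm D)) : (size F).-tuple (pperm D) :=
  [tuple of [seq (lft t \o c) s | s <- in_tuple F]].
have hB t : t \in A -> h t \in B.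
  move=> /lftP[St _]; rewrite inE; apply/asboolP; exists (lft t \o c); split=> //.
  exact: H1.
rewrite -sum1_card (partition_big h (mem B))//= -sum_nat_const.
apply: leq_sum => b bB; rewrite (eq_bigl (fun t => t \in [set t in A | h t == b]%SET)); last first.
  by move=> t; rewrite [in RHS]inE.
rewrite sum1_card; apply: card_tuple_ball => // t t'.
rewrite inE => /andP[tA /eqP tb]; rewrite inE => /andP[t'A /eqP t'b] i.
have [St Et] := lftP t tA; have [St' Et'] := lftP t' t'A.
have hE : [seq (lft t \o c) s | s <- F] = [seq (lft t' \o c) s | s <- F].
  by have /(congr1 val) := etrans tb (esym t'b).
rewrite !(tnth_nth (lft t (pid X))) -Et -Et' !(nth_map (pid X))//.
by apply: H2 => //; exact: nth_In.
Qed.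

End Counting.

(** * Asymptotics on the scale D log D *)

Section Growth.
Context (R : realType).

(** After division by [D * ln D] the power of 2 contributes [e * ln 2 / ln D] and the power of
    [D.+1] at most [2 * e * kappa]; each is at most [eps / 2]. *)
Lemma ln_ratio_le (a b e K D : nat) (kappa eps : R) :
  (0 < a)%N -> (2 <= D)%N -> (a <= b * (2 ^ (e * D) * D.+1 ^ K))%N ->
  K%:R <= e%:R * (kappa * D%:R) ->
  e%:R * ln 2 <= eps / 2 * ln (D%:R : R) -> e%:R * kappa <= eps / 4 ->
  ln (a%:R : R) / (D%:R * ln D%:R) <= ln (b%:R : R) / (D%:R * ln D%:R) + eps.
Proof.
move=> a0 D2 ab hK he hk.
have b0 : (0 < b)%N.
  by case: b ab => // ab; move: (leq_trans a0 ab); rewrite mul0n.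
have D1 : 1 < D%:R :> R by rewrite ltr1n.
have Dpos : 0 < D%:R :> R by rewrite ltr0n; exact: ltnW.
have lnD : 0 < ln (D%:R : R) by exact: ln_gt0.
have DlnD : 0 < D%:R * ln (D%:R : R) by rewrite mulr_gt0.
(* This is [D + 1 <= D^2], valid from [D = 2] on. *)
have lnS : ln (D.+1%:R : R) <= 2 * ln (D%:R : R).
  rewrite mulr_natl -lnXn// ler_ln ?posrE ?ltr0n ?exprn_gt0//.
  by rewrite -natrX ler_nat; nia.
have lna : ln (a%:R : R) <= ln b%:R + (ln 2 *+ (e * D) + ln D.+1%:R *+ K).
  rewrite -!lnXn ?ltr0n// -!lnM ?posrE ?mulr_gt0 ?exprn_gt0 ?ltr0n//.
  rewrite ler_ln ?posrE ?mulr_gt0 ?exprn_gt0 ?ltr0n//.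
  by rewrite -!natrX -!natrM ler_nat.
have h1 : ln 2 *+ (e * D) <= eps / 2 * (D%:R * ln (D%:R : R)).
  have -> : ln 2 *+ (e * D) = D%:R * (e%:R * ln 2) :> R.
    by rewrite -[LHS]mulr_natl natrM; ring.
  by rewrite [leRHS]mulrCA ler_pM2l.
have h2 : ln (D.+1%:R : R) *+ K <= eps / 2 * (D%:R * ln D%:R).
  rewrite -[leLHS]mulr_natl; apply: le_trans (_ : _ <= K%:R * (2 * ln (D%:R : R))) _.
    by rewrite ler_wpM2l.
  apply: le_trans (_ : _ <= (e%:R * (kappa * D%:R)) * (2 * ln (D%:R : R))) _.
    by rewrite ler_wpM2r// mulr_ge0// ltW.
  have -> : e%:R * (kappa * D%:R) * (2 * ln D%:R) =
    (e%:R * kappa) * (2 * (D%:R * ln (D%:R : R))) by ring.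
  apply: le_trans (_ : _ <= (eps / 4) * (2 * (D%:R * ln (D%:R : R)))) _.
    by rewrite ler_wpM2r// mulr_ge0// ltW.
  by rewrite mulrA; have -> : eps / 4 * 2 = eps / 2 by field.
rewrite -lerBlDl -mulrBl ler_pdivrMr//.
move: lna h1 h2; set u := D%:R * _; set A := ln a%:R; set B := ln b%:R.
set C := _ *+ _; set G := _ *+ _; clear; lra.
Qed.

Lemma ln_eventually_ge (e : nat) (eps : R) : 0 < eps ->
  exists D0, forall D, (D0 <= D)%N -> (2 <= D)%N /\ e%:R * ln 2 <= eps / 2 * ln (D%:R : R).
Proof.
move=> eps0; pose x : R := expR (e%:R * ln 2 / (eps / 2)).
exists (maxn 2 (Num.truncn x).+1) => D; rewrite geq_max => /andP[D2 xD]; split=> //.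
have e2 : 0 < eps / 2 by rewrite divr_gt0.
suff : e%:R * ln 2 / (eps / 2) <= ln (D%:R : R) by rewrite ler_pdivrMr// [leRHS]mulrC.
rewrite -[leLHS]expRK ler_ln ?posrE ?expR_gt0//; last by rewrite ltr0n; apply: leq_trans D2.
have /andP[_ /ltW xx] := truncn_itv (expR_ge0 _ : 0 <= x).
by apply: le_trans xx _; rewrite ler_nat.
Qed.

End Growth.

(** * Monotonicity up to a constant of the three kinds of limit *)

Section LimitsUpToConstant.
Context (R : realType).
Local Open Scope ereal_scope.
Implicit Types u v : nat -> \bar R.

Lemma limn_esup_leD u v (e : R) :
  (exists N, forall n, (N <= n)%N -> u n <= v n + e%:E) ->
  limn_esup u <= limn_esup v + e%:E.
Proof.
move=> [N H]; rewrite -leeBlDr//; apply: le_ereal_inf_tmp => _ [V FV <-].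
rewrite leeBlDr//.
apply: le_trans (_ : _ <= ereal_sup (u @` (V `&` [set n | (N <= n)%N]))) _.
  apply: ereal_inf_lbound; exists (V `&` [set n | (N <= n)%N]) => //.
  by apply: filterI => //; exists N.
apply: ge_ereal_sup => _ [n [Vn Nn] <-]; apply: le_trans (H n Nn) _.
rewrite leeD2r//; apply: ereal_sup_ubound; by exists n.
Qed.

Lemma limn_einf_leD u v (e : R) :
  (exists N, forall n, (N <= n)%N -> u n <= v n + e%:E) ->
  limn_einf u <= limn_einf v + e%:E.
Proof.
move=> [N H]; rewrite /limn_einf leeNl oppeD ?fin_num_adde_defl// oppeK leeBlDr//.
apply: limn_esup_leD; exists N => n /H.
by rewrite -leeBlDr// -leeN2 oppeB ?fin_num_adde_defl.
Qed.

Section Ultra.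
Context (w : set (set nat)).
Hypothesis ultra : nonprincipal_ultrafilter w.

(** Initial points are removed one at a time: [w] omits each singleton, so it contains the
    complement. *)
Lemma ultra_cofinite N : w [set n | (N <= n)%N].
Proof.
case: ultra => -[wT w0] wS wI wC w1.
elim: N => [|N IH]; first by apply: wS wT _ => n _ /=.
case: (wC [set N]) => [/w1//|wN]; apply: wS (wI _ _ IH wN) _ => n /= [Nn nN].
by rewrite ltn_neqAle Nn andbT; apply/eqP => Nn'; apply: nN.
Qed.

(** An explicit value for the limit along [w]: by the ultrafilter dichotomy, [u] is [w]-almost
    always above anything smaller and below anything larger. *)
Definition usup u := ereal_sup [set x | w [set n | x <= u n]].

Lemma ultra_proper : ProperFilter w.
Proof.
case: ultra => -[wT w0] wS wI _ _; split=> //; split=> // A B AB wA; exact: wS wA AB.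
Qed.

Lemma ultra_gt u (a : \bar R) : a < usup u -> w [set n | a < u n].
Proof.
case: ultra => _ wS _ _ _ /ereal_sup_gt[x wx ax].
by apply: wS wx _ => n /=; exact: lt_le_trans.
Qed.

Lemma ultra_lt u (a : \bar R) : usup u < a -> w [set n | u n < a].
Proof.
case: ultra => _ wS _ wC _ ua.
case: (wC [set n | a <= u n]) => [wa|]; last first.
  by move=> /wS; apply => n /= /negP; rewrite -ltNge.
have : a <= usup u by apply: ereal_sup_ubound.
by rewrite leNgt ua.
Qed.

Lemma ulimE u : ulim w u = usup u.
Proof.
have PF := ultra_proper.
apply: cvg_lim; first exact: ereal_hausdorff.
have [_ wS wI _ _] := ultra.
move=> P /=; rewrite /nbhs /= /fmap /= => HP.
case E : (usup u) HP => [r||] /=.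
- move=> [e /= e0 He].
  have h1 : w [set n | (r - e)%:E < u n] by apply: ultra_gt; rewrite E lte_fin ltrBlDr ltrDl.
  have h2 : w [set n | u n < (r + e)%:E] by apply: ultra_lt; rewrite E lte_fin ltrDl.
  apply: wS (wI _ _ h1 h2) _ => n /= [].
  case: (u n) => [s||] //=; rewrite !lte_fin => l1 l2.
  by apply: He => /=; rewrite distrC ltr_norml; apply/andP; split; lra.
- move=> [M [_ HM]]; have : w [set n | M%:E < u n] by apply: ultra_gt; rewrite E ltry.
  by move/wS; apply => n; exact: HM.
- move=> [M [_ HM]]; have : w [set n | u n < M%:E] by apply: ultra_lt; rewrite E ltNyr.
  by move/wS; apply => n; exact: HM.
Qed.

Lemma ulim_leD u v (e : R) :
  (exists N, forall n, (N <= n)%N -> u n <= v n + e%:E) ->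
  ulim w u <= ulim w v + e%:E.
Proof.
have [_ wS wI _ _] := ultra.
move=> [N H]; rewrite !ulimE; apply: ge_ereal_sup => x /= wx.
rewrite -leeBlDr//; apply: ereal_sup_ubound.
apply: wS (wI _ _ wx (ultra_cofinite N)) _ => n [xu Nn].
by rewrite /mkset leeBlDr//; exact: le_trans (H n Nn).
Qed.
End Ultra.
End LimitsUpToConstant.

(** * Comparison of the invariants and conclusion *)

Section Comparison.
Context (R : realType) (d : measure_display) (X : measurableType d)
  (mu : probability X R) (Rel : X -> X -> Prop).
Hypothesis Xstd : standard_borel R X.
Hypothesis RelE : countable_borel_equiv Rel.
Hypothesis Rpmp : pmp mu Rel.
Context (E F : seq (pbij X)).
Hypothesis ER : forall s, List.In s E -> inR Rel s.
Hypothesis FR : forall s, List.In s F -> inR Rel s.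
Hypothesis Egen : dyn_gen mu Rel E.
Hypothesis Fgen : dyn_gen mu Rel F.

Lemma sterm_le n0 (delta0 eps : R) : 0 < delta0 -> 0 < eps ->
  exists m delta', 0 < delta' /\ exists D0, forall D, (D0 <= D)%N ->
    (sterm mu E m delta' D <= sterm mu F n0 delta0 D + eps%:E)%E.
Proof.
move=> d00 eps0.
(* The successor keeps [kappa] positive when [E] is empty. *)
pose kappa := eps / 4 / (size E).+1%:R.
have k0 : 0 < kappa by rewrite !divr_gt0// ltr0n.
have hk : (size E)%:R * kappa <= eps / 4.
  rewrite /kappa mulrCA ger_pMr ?divr_gt0// ler_pdivrMr ?ltr0n// mul1r ler_nat.
  exact: leqnSn.
have [m [delta' [d'0 [c Hc]]]] := transfer Xstd RelE Rpmp ER FR Egen Fgen n0 d00 k0.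
exists m, delta'; split=> //.
have [D0 HD] := ln_eventually_ge (size E) eps0.
exists D0 => D /HD[D2 hD]; have [H1 H2] := Hc D.
have D1 : (0 < D)%N by exact: ltnW.
have le := NSA_transfer D1 (ltW k0) H1 H2.
rewrite /sterm; case: (posnP (NSA mu E m delta' D)) => [_|a0]; first by rewrite leNye.
(* The value [-oo] on the right is excluded: the counting bound would make the count for [E] zero as
   well. *)
case: (posnP (NSA mu F n0 delta0 D)) => [b0|b0].
  by move: (leq_trans a0 le); rewrite b0 mul0n.
rewrite -EFinD lee_fin.
apply: ln_ratio_le a0 D2 le _ hD hk.
by rewrite truncn_le !mulr_ge0// ltW.
Qed.

(** Abstracting over [Lim] treats the upper limit, the lower limit and the ultralimit at once. *)
Lemma inf_sterm_le (Lim : (nat -> \bar R) -> \bar R) :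
  (forall u v (e : R), (exists N, forall n, (N <= n)%N -> (u n <= v n + e%:E)%E) ->
     (Lim u <= Lim v + e%:E)%E) ->
  (ereal_inf (range (fun n : nat =>
     ereal_inf [set Lim (sterm mu E n delta) | delta in [set delta : R | (0 < delta)%R]])) <=
   ereal_inf (range (fun n : nat =>
     ereal_inf [set Lim (sterm mu F n delta) | delta in [set delta : R | (0 < delta)%R]])))%E.
Proof.
move=> HLim; apply/lee_addgt0Pr => eps eps0; rewrite -leeBlDr//.
apply: le_ereal_inf_tmp => _ [n0 _ <-]; apply: le_ereal_inf_tmp => _ [delta0 d00 <-].
rewrite leeBlDr//; have [m [delta' [d'0 H]]] := sterm_le n0 d00 eps0.
apply: le_trans (HLim _ _ _ H).
apply: le_trans (_ : _ <= ereal_inf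
  [set Lim (sterm mu E m delta) | delta in [set delta : R | (0 < delta)%R]])%E _.
  by apply: ereal_inf_lbound; exists m.
by apply: ereal_inf_lbound; exists delta'.
Qed.

End Comparison.

Theorem theorem1p1 (R : realType) (d : measure_display) (X : measurableType d)
  (mu : probability X R) (Rel : X -> X -> Prop)
  (Xstd : standard_borel R X)
  (Rcber : countable_borel_equiv Rel)
  (Rpmp : pmp mu Rel)
  (E F : seq (pbij X))
  (E_in : forall s, List.In s E -> inR Rel s)
  (F_in : forall s, List.In s F -> inR Rel s)
  (E_gen : dyn_gen mu Rel E) (F_gen : dyn_gen mu Rel F) :
  [/\ s_up mu E = s_up mu F, s_low mu E = s_low mu F &
      forall w : set (set nat), nonprincipal_ultrafilter w ->
        s_ult mu w E = s_ult mu w F].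
Proof.
have key (Lim : (nat -> \bar R) -> \bar R) := inf_sterm_le Xstd Rcber Rpmp
  E_in F_in E_gen F_gen (Lim := Lim).
have key' (Lim : (nat -> \bar R) -> \bar R) := inf_sterm_le Xstd Rcber Rpmp
  F_in E_in F_gen E_gen (Lim := Lim).
split=> [||w ultra]; apply/eqP; rewrite eq_le; apply/andP; split.
- exact/key/limn_esup_leD.
- exact/key'/limn_esup_leD.
- exact/key/limn_einf_leD.
- exact/key'/limn_einf_leD.
- exact/key/ulim_leD.
- exact/key'/ulim_leD.
Qed.
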